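(* Let $N\ge 2$ be an integer, let $\delta\ge 0$ and let $\lambda>12\delta+8\delta^2$. Then the process $X^N=(X^N_1,\dots,X^N_N)$ on $\mathbb{N}^N$ (the small jump model with parameters $N,\delta,\lambda$) is exponentially ergodic, i.e. there exist a unique probability measure $\pi^N$ on $\mathbb{N}^N$ and $\rho_N<1$ such that, for any initial condition $x\in\mathbb{N}^N$ and time $t>0$, $$\big\|P^N_x\big((X^N_1(t),\dots,X^N_N(t))\in\cdot\big)-\pi^N\big\|_{TV}\le C_N(x)\,\rho_N^{\,t},$$ where $C_N(x)$ is bounded.
   Context: $\mathbb{N}=\{0,1,2,\dots\}$. The small jump model with $N$ particles and parameters $\delta\ge0$, $\lambda$ is the continuous-time Markov chain $X^N=(X^N_1,\dots,X^N_N)$ on $\mathbb{N}^N$ in which, for each $i=1,\dots,N$, the coordinate $X^N_i$ makes the following jumps (one coordinate moving at a time). If $X^N_i>0$, it jumps to $X^N_i+1$ at rate $1+\delta$ and to $X^N_i-1$ at rate $1+\lambda\,\frac1N\sum_{k=1}^N\mathbf 1(X^N_k<X^N_i)$. If $X^N_i=0$, the only allowed jump is to $X^N_i+1=1$, at rate $1+\delta$. $P^N_x$ denotes the law of $X^N$ started from $x\in\mathbb{N}^N$, and $\|\cdot\|_{TV}$ is the total variation norm.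
   Formalization: ''C_N(x) is bounded'' is read as: C_N(x) is finite for each x and independent of t; a bound uniform in x is impossible, since the jump rates are bounded and a process started far away stays far from equilibrium at any fixed time. *)

(* Defs.v *)
From HB Require Import structures.
From mathcomp Require Import all_boot all_order all_algebra.
From mathcomp Require Import all_classical all_reals all_analysis.

Set Implicit Arguments.
Unset Strict Implicit.
Unset Printing Implicit Defensive.

Import Order.TTheory GRing.Theory Num.Theory.
Import numFieldNormedType.Exports.

Local Open Scope classical_set_scope.
Local Open Scope ring_scope.

(* States are [N.-tuple nat] with the library's product sigma-algebra, nat
   being discrete.  As the tuples form a countable set, all sets of states are
   measurable. *)

Section Rates.
Variables (R : realType) (N : nat) (delta lambda : R).
Implicit Types x y : N.-tuple nat.

Definition incr x (i : 'I_N) : N.-tuple nat :=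
  [tuple if j == i then (tnth x j).+1 else tnth x j | j < N].

Definition decr x (i : 'I_N) : N.-tuple nat :=
  [tuple if j == i then (tnth x j).-1 else tnth x j | j < N].

Definition rate_up : R := 1 + delta.

Definition rate_down x (i : 'I_N) : R :=
  if (0 < tnth x i)%N then
    1 + lambda * (N%:R^-1 * \sum_(k < N) (tnth x k < tnth x i)%N%:R)
  else 0.

(* Rate of jumps from x to y.  Where [decr x i] is truncated (and equal to x),
   its weight [rate_down x i] is 0, so that [jump_rate x x = 0]. *)
Definition jump_rate x y : R :=
  \sum_(i < N) (rate_up * (y == incr x i)%:R
                + rate_down x i * (y == decr x i)%:R).

Definition exit_rate x : R := \sum_(i < N) (rate_up + rate_down x i).

Definition qmatrix x y : R := jump_rate x y - exit_rate x * (y == x)%:R.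

End Rates.

(* [P x] is the law of the process started from x, and X the process, of which
   only the values at nonnegative times matter. *)
Record small_jump_model (R : realType) (N : nat) (delta lambda : R)
    (d : measure_display) (Omega : measurableType d)
    (P : N.-tuple nat -> probability Omega R)
    (X : R -> {mfun Omega >-> N.-tuple nat}) : Prop := SmallJumpModel {
  sjm_start : forall x, P x [set w | X 0 w = x] = 1%E ;
  sjm_right_continuous : forall (w : Omega) (t : R), 0 <= t ->
    \forall s \near t^'+, X s w = X t w ;
  (* The time-homogeneous Markov property
       P_x(X(t_{n+1}) = y_{n+1} | X(t_0) = y_0, ..., X(t_n) = y_n)
         = P_{y_n}(X(t_{n+1} - t_n) = y_{n+1}),
     multiplied by the probability of the conditioning event. *)
  sjm_markov : forall x (n : nat) (t : nat -> R) (y : nat -> N.-tuple nat),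
    0 <= t 0%N -> nondecreasing_seq t ->
    P x (\bigcap_(k < n.+2) [set w | X (t k) w = y k]) =
    (P x (\bigcap_(k < n.+1) [set w | X (t k) w = y k]) *
     P (y n) [set w | X (t n.+1 - t n)%R w = y n.+1])%E ;
  (* P_x(X(h) = y) = 1(x = y) + q(x, y) h + o(h) as h tends to 0+ *)
  sjm_rates : forall x y,
    h^-1 * (fine (P x [set w | X h w = y]) - (y == x)%:R)
      @[h --> 0^'+] --> qmatrix delta lambda x y }.

(* The supremum over events of the difference; the total mass of the variation
   of the signed measure mu - nu is twice this quantity. *)
Definition tv_dist (R : realType) (d : measure_display) (T : measurableType d)
    (mu nu : probability T R) : \bar R :=
  ereal_sup [set `|mu A - nu A|%E | A in [set A | measurable A]].

(* The rate rho does not depend on the initial state x; the prefactor C x is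
   finite and does not depend on the time t.  It is not bounded uniformly in x:
   the jump rates being bounded, at any given time the process is still far
   from the origin if it starts far enough, so that no bound uniform in x can
   tend to 0. *)
Definition converges_exponentially (R : realType) (N : nat)
    (d : measure_display) (Omega : measurableType d)
    (P : N.-tuple nat -> probability Omega R)
    (X : R -> {mfun Omega >-> N.-tuple nat})
    (pi : probability (N.-tuple nat) R) : Prop :=
  exists rho : R, 0 < rho < 1 /\
  exists C : N.-tuple nat -> R, forall (x : N.-tuple nat) (t : R), 0 < t ->
    (tv_dist (distribution (P x) (X t)) pi <= (C x * rho `^ t)%:E)%E.

(* Main.v *)
Require Import Defs.
From HB Require Import structures.
From mathcomp Require Import all_boot all_order all_algebra.
From mathcomp Require Import all_classical all_reals all_analysis.
From mathcomp Require Import ring lra.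

Set Implicit Arguments.
Unset Strict Implicit.
Unset Printing Implicit Defensive.

Import Order.TTheory GRing.Theory Num.Theory.
Import numFieldNormedType.Exports.

Local Open Scope classical_set_scope.
Local Open Scope ring_scope.

(** The proof has a probabilistic part, which provides a Lyapunov function, and
    an analytic part, which deduces the convergence of the process from it.

    Lyapunov function.  Up to terms of second order in [s], the generator
    multiplies [(1 + s) ^+ x_i] by [s] times the drift of particle [i], which
    is [delta] minus [lambda] times the proportion of particles strictly below
    [i].  Seen pair by pair, this drift is a competition: an untied pair
    contributes a downward pull to its upper particle, which carries the larger
    exponential, and a tied pair contributes nothing but the upward drift.
    However, a tie between two particles above 0 is broken at rate at least
    [4 + 2 * delta], while the pairs at distance 1 create ties at a bounded
    rate.  Therefore the weighted number of ties, added to the sum of the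
    exponentials with a coefficient proportional to [kappa], transfers a part
    of the negative drift of the untied pairs to the tied ones; the condition on
    [lambda] leaves room for such a [kappa] ([gen_tie], [pair_drift],
    [lyapunov_parameters], [lyapunov_function]).  Particles at 0, which are not
    pulled down, carry a bounded weight.  Exponentials are essential: for a
    linear function, the reflection of some particles at 0 could outweigh the
    descent of the others.

    Discrete chain.  The rates being bounded by [clock], the process is a
    Poissonization of a discrete Markov chain, [jump_chain], which has finitely
    many possible jumps from each state, so that its action on unbounded
    functions is elementary.  The Lyapunov drift and the accessibility of the
    origin ([jump_chain_origin]) give the geometric contraction of this
    chain by the argument of Hairer and Mattingly for Harris' theorem
    ([harris_contraction], [harris_theorem]).

    Continuous time.  The powers of [lazy p K] are binomial mixtures of the
    powers of [K]; with [p] of order [1 / n], they converge to the Poisson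
    mixture which is the law of the process.  This convergence is proved directly
    from the infinitesimal description: at a fixed state, the rates and the
    Markov property give the backward equation with an error [o(h)]
    ([trans_backward]); the diagonal transition probabilities being
    supermultiplicative, the transition probabilities are Lipschitz in time with
    a constant that does not depend on the state, which improves the error to
    [O(h ^+ 2)], uniformly ([trans_expansion]), and makes the Euler scheme
    converge ([euler_approximation]).  Hence the law of the process at time [t]
    forgets the starting point at an exponential rate, and is a Cauchy family as
    [t] grows, uniformly in the event ([harris_continuous_time]).

    Limit.  A uniform limit of probability measures is a probability measure
    ([uniform_limit_probability]), and it is the only possible limit. *)

(** * Markov operators *)

(** Markov kernels are represented by their action on functions.  All functions
    are admitted, unbounded ones included: the kernels of interest have finitely
    many possible jumps from each state, so that no integrability is at stake. *)
Record markov_operator (R : realType) (S : Type) (K : (S -> R) -> S -> R) :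
    Prop := MarkovOperator {
  markov_linear : forall a f g x,
    K (fun y => a * f y + g y) x = a * K f x + K g x ;
  markov_one : forall x, K (fun=> 1) x = 1 ;
  markov_ge0 : forall f, (forall y, 0 <= f y) -> forall x, 0 <= K f x }.

Section MarkovOperators.
Context {R : realType} {S : Type}.
Implicit Types (K : (S -> R) -> S -> R) (f g V : S -> R).

Section Basics.
Variables (K : (S -> R) -> S -> R) (hK : markov_operator K).

Lemma markov_zero x : K (fun=> 0) x = 0.
Proof.
have := markov_linear hK 1 (fun=> 0) (fun=> 0) x.
have -> : (fun y : S => 1 * 0 + 0) = (fun=> 0 : R).
  by apply: funext => y; rewrite mulr0 addr0.
by move/eqP; rewrite mul1r -subr_eq0 opprD addNKr oppr_eq0 => /eqP.
Qed.

Lemma markov_scale a f x : K (fun y => a * f y) x = a * K f x.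
Proof.
rewrite -[RHS]addr0 -(markov_zero x) -(markov_linear hK).
by congr (K _ x); apply: funext => y; rewrite addr0.
Qed.

Lemma markov_add f g x : K (fun y => f y + g y) x = K f x + K g x.
Proof.
rewrite -[K f x]mul1r -(markov_linear hK).
by congr (K _ x); apply: funext => y; rewrite mul1r.
Qed.

Lemma markov_const c x : K (fun=> c) x = c.
Proof.
rewrite -[RHS]mulr1 -(markov_one hK x) -markov_scale.
by congr (K _ x); apply: funext => y; rewrite mulr1.
Qed.

Lemma markov_sub f g x : K (fun y => f y - g y) x = K f x - K g x.
Proof.
have := markov_linear hK (-1) g f x; rewrite mulN1r addrC => <-.
by congr (K _ x); apply: funext => y; rewrite mulN1r addrC.
Qed.

Lemma markov_le f g : (forall y, f y <= g y) -> forall x, K f x <= K g x.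
Proof.
move=> fg x; rewrite -subr_ge0 -markov_sub.
by apply: (markov_ge0 hK) => y; rewrite subr_ge0.
Qed.

Lemma markov_norm f g : (forall y, `|f y| <= g y) ->
  forall x, `|K f x| <= K g x.
Proof.
move=> fg x; rewrite ler_norml; apply/andP; split.
  rewrite -[X in - X]mul1r -mulNr -markov_scale; apply: markov_le => y.
  by rewrite mulN1r; have := fg y; rewrite ler_norml => /andP[].
by apply: markov_le => y; exact: le_trans (ler_norm _) (fg y).
Qed.

Lemma markov_dist f c b : (forall y, `|f y - c| <= b) ->
  forall x, `|K f x - c| <= b.
Proof.
move=> fc x; rewrite -[c in `|_ - c|](markov_const c x) -markov_sub.
by rewrite -[b](markov_const b x); exact: markov_norm.
Qed.

Lemma markov_iter n : markov_operator (iter n K).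
Proof.
elim: n => [|n IH]; first by split => // f + x; apply.
split => /= [a f g x|x|f f0 x].
- rewrite -(markov_linear hK); congr (K _ x); apply: funext => y.
  exact: (markov_linear IH).
- rewrite -[RHS](markov_one hK x); congr (K _ x); apply: funext => y.
  exact: (markov_one IH).
- by apply: (markov_ge0 hK) => y; exact: (markov_ge0 IH).
Qed.

End Basics.

(** With the constant written as [(1 - g) * b], the drift condition says that
    [V] is contracted towards the level [b]; in this form it is stable under
    iteration and under mixture with the identity. *)
Definition drift K V (g b : R) := forall x, K V x <= g * V x + (1 - g) * b.

Lemma drift_iter K V (g b : R) n : markov_operator K -> 0 <= g ->
  drift K V g b -> drift (iter n K) V (g ^+ n) b.
Proof.
move=> hK g0 hd; elim: n => [|n IH] x /=.
  by rewrite expr0 mul1r subrr mul0r addr0.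
apply: (le_trans (markov_le hK IH x)).
rewrite (markov_linear hK) (markov_const hK).
have := ler_wpM2l (exprn_ge0 n g0) (hd x); rewrite exprSr.
by set u := g ^+ n; lra.
Qed.

(** * Harris' theorem *)

(** The Lipschitz functions for the distance [w x + w y] between distinct
    points are the translates of the functions bounded by [w]; the constant
    is the supremum of [f - r * w]. *)
Lemma lipschitz_recentre (w f : S -> R) (r : R) (x0 : S) :
    (forall x y, `|f x - f y| <= r * (w x + w y)) ->
  exists c, forall x, `|f x - c| <= r * w x.
Proof.
move=> hf; pose E := [set f x - r * w x | x in setT].
have ubE y : ubound E (f y + r * w y).
  move=> _ [x _ <-]; have := hf x y; rewrite ler_norml => /andP[_].
  by rewrite mulrDr; lra.
have E0 : E !=set0 by exists (f x0 - r * w x0), x0.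
exists (sup E) => x; rewrite ler_norml; apply/andP; split.
  by rewrite lerBrDl lerBlDr; apply: ge_sup.
have : f x - r * w x <= sup E.
  by apply: ub_le_sup; [exists (f x + r * w x) | exists x].
by lra.
Qed.

(** The contraction estimate of Hairer and Mattingly, for the weighted distance
    [2 + beta * (V x + V y)] between distinct points.  If [V x + V y] is large,
    the drift condition decreases the distance.  If it is small, both points
    belong to the sublevel set from which the operator jumps to [z] with
    probability at least [alpha], which decreases the constant 2; the
    coefficient [beta] is chosen so small that the increase of [V] does not
    undo this gain. *)
Lemma harris_contraction K V (g b L alpha : R) (z : S) :
    markov_operator K -> (forall x, 0 <= V x) ->
    0 <= g < 1 -> 0 <= b -> drift K V g b -> 4 * b < L ->
    0 < alpha <= 1 ->
    (forall f, (forall y, 0 <= f y) ->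
      forall x, V x <= L -> alpha * f z <= K f x) ->
  exists beta rho : R, [/\ 0 < beta, 0 < rho < 1 &
    forall f (r : R), (forall x y, `|f x - f y| <= r * (2 + beta * (V x + V y))) ->
      forall x y, `|K f x - K f y| <= rho * r * (2 + beta * (V x + V y))].
Proof.
move=> hK V0 /andP[g0 g1] b0 hd hL /andP[al0 al1] hmin.
pose beta := alpha / (2 * b + 1).
have b1 : 0 < 2 * b + 1 by lra.
have beta0 : 0 < beta by rewrite divr_gt0.
have beta_b : 2 * beta * b <= alpha.
  have : beta * (2 * b + 1) = alpha by rewrite /beta mulfVK // gt_eqF.
  by lra.
(* As [4 * b < L], the drift condition contracts [V x + V y] by the factor [g']
   when it is at least [L]; the ratio [rho1] is reached when it is equal to
   [L]. *)
pose g' := (1 + g) / 2.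
pose rho1 := (2 + beta * g' * L) / (2 + beta * L).
have L0 : 0 < L by lra.
have bL0 : 0 < beta * L by rewrite mulr_gt0.
have d0 : 0 < 2 + beta * L by lra.
have rho1E : rho1 * (2 + beta * L) = 2 + beta * g' * L.
  by rewrite /rho1 mulfVK // gt_eqF.
have rho1_lt1 : rho1 < 1.
  rewrite ltr_pdivrMr // mul1r ltrD2l -mulrA (mulrC g') mulrA gtr_pMr //.
  by rewrite /g'; lra.
have g'_rho1 : g' <= rho1.
  rewrite ler_pdivlMr // mulrDr; apply: lerD; first by rewrite /g'; lra.
  by rewrite mulrCA mulrA.
have rho1_ge0 : 0 <= rho1 by apply: le_trans g'_rho1; rewrite /g'; lra.
pose rho := Num.max rho1 (1 - alpha / 2).
have rho_lt1 : rho < 1 by rewrite gt_max rho1_lt1 /=; lra.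
have rho_ge : rho1 <= rho /\ 1 - alpha / 2 <= rho.
  by split; rewrite le_max lexx ?orbT.
have rho_gt0 : 0 < rho by lra.
exists beta, rho; split => //; first exact/andP.
move=> f r hf.
have r0 : 0 <= r.
  have := hf z z; rewrite subrr normr0 => h.
  have Dz : 0 < 2 + beta * (V z + V z).
    by have := mulr_ge0 (ltW beta0) (addr_ge0 (V0 z) (V0 z)); lra.
  by rewrite -(pmulr_lge0 _ Dz).
pose w x := 1 + beta * V x.
have w0 x : 0 <= w x by rewrite /w; have := mulr_ge0 (ltW beta0) (V0 x); lra.
have [c hc] : exists c, forall x, `|f x - c| <= r * w x.
  apply: (lipschitz_recentre z) => x y; apply: le_trans (hf x y) _.
  by rewrite /w; lra.
(* By symmetry, one sign is enough. *)
suff one_sided x y : K f x - K f y <= rho * r * (2 + beta * (V x + V y)).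
  move=> x y; rewrite ler_norml one_sided andbT.
  by have := one_sided y x; rewrite (addrC (V y)); lra.
have Kw u : K w u = 1 + beta * K V u.
  rewrite /w -(markov_scale hK) -[1 in RHS](markov_const hK 1 u).
  exact: (markov_add hK).
have Krw u : K (fun y => r * w y) u = r * K w u by exact: (markov_scale hK).
have Kc u : K (fun y => f y - c) u = K f u - c.
  by rewrite (markov_sub hK) (markov_const hK).
have KVW : K V x + K V y <= g * (V x + V y) + 2 * ((1 - g) * b).
  by have := hd x; have := hd y; lra.
have W0 : 0 <= V x + V y by rewrite addr_ge0.
have [far|near] := leP L (V x + V y).
  have up : K f x - c <= r * K w x.
    rewrite -Kc -Krw; apply: (markov_le hK) => u.
    by apply: le_trans (hc u); exact: ler_norm.
  have lo : - (r * K w y) <= K f y - c.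
    rewrite -Kc -Krw -mulN1r -(markov_scale hK); apply: (markov_le hK) => u.
    by rewrite mulN1r; have := hc u; rewrite ler_norml => /andP[].
  have step : 2 + beta * (K V x + K V y) <= rho * (2 + beta * (V x + V y)).
    set W := V x + V y in KVW W0 far *.
    apply: (@le_trans _ _ (rho1 * (2 + beta * W))); last first.
      rewrite ler_wpM2r // ?(rho_ge.1) //.
      by have := mulr_ge0 (ltW beta0) W0; lra.
    have h1 : beta * (K V x + K V y) <= beta * (g' * W).
      rewrite ler_wpM2l ?(ltW beta0) //; apply: le_trans KVW _.
      have : (1 - g) * (W - 4 * b) >= 0 by rewrite mulr_ge0 //; lra.
      by rewrite /g'; lra.
    have h2 : 0 <= (rho1 - g') * (beta * (W - L)).
      by rewrite mulr_ge0 ?subr_ge0 // mulr_ge0 ?(ltW beta0) // subr_ge0.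
    by lra.
  have := ler_wpM2l r0 step.
  by rewrite (mulrC rho) -mulrA; move: up lo; rewrite !Kw; lra.
have Vx : V x <= L by have := V0 y; lra.
have Vy : V y <= L by have := V0 x; lra.
have up : alpha * (r * w z - (f z - c)) <= r * K w x - (K f x - c).
  rewrite -Kc -Krw -(markov_sub hK).
  apply: (hmin (fun u => r * w u - (f u - c))) => // u.
  by rewrite subr_ge0; apply: le_trans (hc u); exact: ler_norm.
have lo : alpha * (r * w z + (f z - c)) <= r * K w y + (K f y - c).
  rewrite -Kc -Krw -(markov_add hK).
  apply: (hmin (fun u => r * w u + (f u - c))) => // u.
  by rewrite addrC -lerBlDr sub0r; have := hc u; rewrite ler_norml => /andP[].
have gain : alpha * r <= alpha * (r * w z).
  rewrite ler_wpM2l ?(ltW al0) // ler_peMr // /w lerDl.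
  by rewrite mulr_ge0 // ltW.
have step : 2 - alpha + beta * (g * (V x + V y))
    <= rho * (2 + beta * (V x + V y)).
  have bW : 0 <= beta * (V x + V y) by rewrite mulr_ge0 // ltW.
  have gr : g <= rho.
    by apply: le_trans (rho_ge.1); apply: le_trans g'_rho1; rewrite /g'; lra.
  have := ler_wpM2r bW gr.
  have := rho_ge.2.
  by lra.
have KVW' : beta * (K V x + K V y) <= beta * (g * (V x + V y)) + alpha.
  apply: (@le_trans _ _ (beta * (g * (V x + V y) + 2 * ((1 - g) * b)))).
    by rewrite ler_wpM2l // ltW.
  by have := mulr_ge0 (ltW beta0) (mulr_ge0 g0 b0); lra.
have := ler_wpM2l r0 step; have := ler_wpM2l r0 KVW'.
by move: up lo gain; rewrite !Kw; lra.
Qed.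

Lemma bernoulli_inequality (a : R) n : 0 <= a <= 1 ->
  1 - n%:R * a <= (1 - a) ^+ n.
Proof.
move=> /andP[a0 a1]; elim: n => [|n IH]; first by rewrite mul0r subr0 expr0.
rewrite exprS -natr1 mulrDl mul1r.
have p1 : 0 <= 1 - a by rewrite subr_ge0.
have := ler_wpM2l p1 IH.
have : 0 <= n%:R * a * a by rewrite !mulr_ge0.
by set u := (1 - a) ^+ n; lra.
Qed.

(** The contraction is applied to a power [K ^ m], as [K] itself may need
    several steps to reach [z].  The rate [rho0] of [K ^ m] is turned into the
    rate [1 - (1 - rho0) / m] of [K] by Bernoulli's inequality. *)
Theorem harris_theorem K V (g b : R) (z : S) :
    markov_operator K -> (forall x, 0 <= V x) ->
    0 <= g < 1 -> 0 <= b -> drift K V g b ->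
    (forall L, exists m (alpha : R), [/\ (0 < m)%N, 0 < alpha <= 1 &
      forall f, (forall y, 0 <= f y) ->
        forall x, V x <= L -> alpha * f z <= iter m K f x]) ->
  exists C rho : R, [/\ 0 <= C, 0 < rho < 1 &
    forall f, (forall x y, `|f x - f y| <= 1) -> forall n x y,
      `|iter n K f x - iter n K f y| <= C * rho ^+ n * (1 + V x + V y)].
Proof.
move=> hK V0 /andP[g0 g1] b0 hd hirr.
have [m [alpha [m0 al hmin]]] := hirr (4 * b + 1).
have gm1 : 0 <= g ^+ m < 1 by rewrite exprn_ge0 // exprn_ilt1 // -lt0n.
have hL : 4 * b < 4 * b + 1 by rewrite ltrDl.
have [beta [rho0 [beta0 /andP[r0 r1] contr]]] :=
  harris_contraction (markov_iter hK m) V0 gm1 b0 (drift_iter m hK g0 hd) hL al hmin.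
have W0 x y : 0 <= V x + V y by rewrite addr_ge0.
have bW0 x y : 0 <= beta * (V x + V y) by rewrite mulr_ge0 // ltW.
have geom k f : (forall x y, `|f x - f y| <= 1) -> forall x y,
    `|iter k (iter m K) f x - iter k (iter m K) f y|
      <= rho0 ^+ k * (2 + beta * (V x + V y)).
  move=> hf; elim: k => [|k IH] x y /=.
    rewrite expr0 mul1r; apply: le_trans (hf x y) _.
    by have := bW0 x y; lra.
  by rewrite exprS; exact: contr IH x y.
have mR : 0 < m%:R :> R by rewrite ltr0n.
pose a := (1 - rho0) / m%:R.
have a01 : 0 < a < 1.
  rewrite divr_gt0 ?subr_gt0 //= ltr_pdivrMr // mul1r.
  apply: (@lt_le_trans _ _ 1); first by lra.
  by rewrite ler1n.
pose rho := 1 - a.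
have [rho_gt0 rho_lt1] : 0 < rho /\ rho < 1 by move: a01; rewrite /rho; lra.
have rho0_le : rho0 <= rho ^+ m.
  have a01' : 0 <= a <= 1 by case/andP: a01 => *; rewrite !ltW.
  apply: le_trans (bernoulli_inequality m a01').
  by rewrite /a mulrC mulfVK ?gt_eqF //; lra.
exists ((2 + beta) / rho ^+ m), rho; split.
- by rewrite divr_ge0 ?exprn_ge0 ?ltW // addr_gt0.
- by rewrite rho_gt0.
move=> f hf n x y.
have iterE u : iter n K f u = iter (n %/ m) (iter m K) (iter (n %% m) K f) u.
  by rewrite {1}(divn_eq n m) iterD iterM.
have hf' u v : `|iter (n %% m) K f u - iter (n %% m) K f v| <= 1.
  have hI := markov_iter hK (n %% m).
  apply: (markov_dist hI) => s; rewrite distrC.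
  by apply: (markov_dist hI) => t; exact: hf.
rewrite !iterE; apply: (le_trans (geom _ _ hf' x y)).
have w_le : 2 + beta * (V x + V y) <= (2 + beta) * (1 + V x + V y).
  by have := W0 x y; have := bW0 x y; lra.
have rate : rho0 ^+ (n %/ m) <= rho ^+ n / rho ^+ m.
  rewrite ler_pdivlMr ?exprn_gt0 //.
  apply: (@le_trans _ _ (rho0 ^+ (n %/ m) * rho ^+ (n %% m))).
    rewrite ler_wpM2l ?exprn_ge0 ?(ltW r0) // ler_wiXn2l ?ltW //.
    exact/ltnW/ltn_pmod.
  rewrite {3}(divn_eq n m) exprD mulnC exprM.
  rewrite ler_wpM2r ?exprn_ge0 ?(ltW rho_gt0) //.
  by rewrite lerXn2r // nnegrE ?exprn_ge0 // ltW.
apply: (@le_trans _ _ (rho ^+ n / rho ^+ m * ((2 + beta) * (1 + V x + V y)))).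
  apply: ler_pM => //; first by rewrite exprn_ge0 // ltW.
  by have := bW0 x y; lra.
by rewrite le_eqVlt; apply/orP; left; apply/eqP; ring.
Qed.

(** * Mixtures with the identity and continuous time *)

(** One Euler step of size [p] for the semigroup of the chain [K] run at the
    times of a Poisson process of rate 1. *)
Definition lazy (p : R) K f x := (1 - p) * f x + p * K f x.

Lemma markov_lazy p K : 0 <= p <= 1 -> markov_operator K ->
  markov_operator (lazy p K).
Proof.
move=> /andP[p0 p1] hK; rewrite /lazy; split => [a f h x|x|f f0 x].
- by rewrite (markov_linear hK); ring.
- by rewrite (markov_one hK); ring.
- by rewrite addr_ge0 // mulr_ge0 ?subr_ge0 // (markov_ge0 hK).
Qed.

Lemma drift_lazy p K V (g b : R) : 0 <= p <= 1 ->
  drift K V g b -> drift (lazy p K) V (1 - p * (1 - g)) b.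
Proof.
move=> /andP[p0 p1] hd x; rewrite /lazy.
by have := ler_wpM2l p0 (hd x); lra.
Qed.

(** A power of [lazy p K] is the binomial mixture of the powers of [K], so that
    the generating function of the binomial law appears at [rho].  The extra
    power [j] is what makes the induction on [n] work. *)
Lemma lazy_geometric p K f (D rho : R) x y : 0 <= p <= 1 -> markov_operator K ->
    (forall j, `|iter j K f x - iter j K f y| <= D * rho ^+ j) ->
  forall n, `|iter n (lazy p K) f x - iter n (lazy p K) f y|
    <= D * (1 - p * (1 - rho)) ^+ n.
Proof.
move=> /andP[p0 p1] hK hf n.
suff H j : `|iter j K (iter n (lazy p K) f) x - iter j K (iter n (lazy p K) f) y|
    <= D * rho ^+ j * (1 - p * (1 - rho)) ^+ n.
  by have := H 0%N; rewrite /= expr0 mulr1.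
elim: n j => [|n IH] j; first by rewrite expr0 mulr1.
set h := iter n (lazy p K) f in IH *.
have step u : iter j K (iter n.+1 (lazy p K) f) u
    = (1 - p) * iter j K h u + p * iter j.+1 K h u.
  rewrite iterS -/h (iterSr j K) -(markov_scale (markov_iter hK j) p).
  exact: (markov_linear (markov_iter hK j)).
rewrite !step.
have -> (a c a' c' : R) : (1 - p) * a + p * c - ((1 - p) * a' + p * c')
    = (1 - p) * (a - a') + p * (c - c') by ring.
apply: le_trans (ler_normD _ _) _; rewrite !normrM (ger0_norm p0).
rewrite (@ger0_norm _ (1 - p)) ?subr_ge0 //.
have p1' : 0 <= 1 - p by rewrite subr_ge0.
have := ler_wpM2l p1' (IH j); have := ler_wpM2l p0 (IH j.+1).
rewrite !exprS; set Z := _ ^+ n; set r := rho ^+ j.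
by lra.
Qed.

End MarkovOperators.

Section ContinuousTime.
Context {R : realType} {S : Type}.
Implicit Types (K : (S -> R) -> S -> R) (f V : S -> R) (u : R -> S -> R).

Lemma le_of_le_add_div (a b c : R) (n0 : nat) :
  (forall n, (n0 <= n)%N -> a <= b + c / n.+1%:R) -> a <= b.
Proof.
move=> h; have [//|ba] := leP a b.
pose n := maxn n0 (Num.trunc (`|c| / (a - b))).
have d0 : 0 < a - b by rewrite subr_gt0.
have lt_n : `|c| / (a - b) < n.+1%:R.
  have c0 : 0 <= `|c| / (a - b) by rewrite divr_ge0 // ltW.
  have := truncn_itv c0 => /andP[_ /lt_le_trans]; apply.
  by rewrite ler_nat ltnS leq_maxr.
have := h n (leq_maxl _ _); rewrite -lerBlDl => h1.
have n0' : 0 < n.+1%:R :> R by rewrite ltr0n.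
move: h1 lt_n; rewrite ler_pdivlMr // ltr_pdivrMr // (mulrC (a - b)) => h1 h2.
by have := ler_norm c; lra.
Qed.

(** Each [u t] plays the role of [P_t f] for a Markov semigroup [P] of which
    [q * (K - I)] is the generator; the local error being quadratic in the
    step, uniformly in the state, the global error of [n] steps is of order
    [1 / n]. *)
Definition euler_consistent K (q c : R) u := forall (t h : R) x,
  0 <= t -> 0 < h -> q * h <= 1 ->
  `|u (t + h) x - lazy (q * h) K (u t) x| <= c * h ^+ 2.

Lemma euler_approximation K (q c : R) u : markov_operator K -> 0 < q ->
    euler_consistent K q c u ->
  forall (t s : R) n x, 0 <= t -> 0 < s -> q * s <= n.+1%:R ->
    `|u (t + s) x - iter n.+1 (lazy (q * (s / n.+1%:R)) K) (u t) x|
      <= c * s ^+ 2 / n.+1%:R.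
Proof.
move=> hK q0 hu t s n x t0 s0 hn; set h := s / n.+1%:R.
have nR : 0 < n.+1%:R :> R by rewrite ltr0n.
have nh : n.+1%:R * h = s by rewrite /h mulrC mulfVK // gt_eqF.
have h0 : 0 < h by rewrite divr_gt0.
have qh1 : q * h <= 1 by rewrite /h mulrA ler_pdivrMr // mul1r.
have hL : markov_operator (lazy (q * h) K).
  by apply: markov_lazy => //; rewrite qh1 mulr_ge0 // ltW.
suff H k y : `|u (t + k%:R * h) y - iter k (lazy (q * h) K) (u t) y|
    <= k%:R * (c * h ^+ 2).
  have := H n.+1 x; rewrite nh => /le_trans; apply.
  rewrite le_eqVlt; apply/orP; left; apply/eqP.
  by rewrite /h; move: nR; move: (n.+1%:R) => m nR; field; rewrite gt_eqF.
elim: k y => [|k IH] y; first by rewrite !mul0r addr0 subrr normr0.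
have -> : t + k.+1%:R * h = t + k%:R * h + h by rewrite -natr1; ring.
have tk : 0 <= t + k%:R * h by rewrite addr_ge0 // mulr_ge0 // ltW.
have e1 := hu _ _ y tk h0 qh1.
have e2 : `|lazy (q * h) K (u (t + k%:R * h)) y
    - lazy (q * h) K (iter k (lazy (q * h) K) (u t)) y| <= k%:R * (c * h ^+ 2).
  rewrite -(markov_sub hL) -[X in _ <= X](markov_const hL _ y).
  exact: (markov_norm hL).
rewrite -[u _ y - _](subrKA (lazy (q * h) K (u (t + k%:R * h)) y)).
apply: le_trans (ler_normD _ _) _; rewrite iterS -natr1 mulrDl mul1r addrC.
exact: lerD.
Qed.

(** The Euler scheme of step [t / n] inherits from Harris' theorem the rate
    [(1 - q * (t / n) * (1 - rho)) ^+ n], which is at most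
    [expR (- (q * (1 - rho) * t))].  The second estimate is the average of the
    first one over the positions reached by the scheme after a time [s]: by the
    drift condition, the mean of [V] over them is at most [V x + b].  The
    constants do not depend on [u], so that the conclusion is uniform over the
    events when [u] describes the probability of an event. *)
Theorem harris_continuous_time K V (g b q : R) (z : S) :
    markov_operator K -> (forall x, 0 <= V x) ->
    0 <= g < 1 -> 0 <= b -> drift K V g b -> 0 < q ->
    (forall L, exists m (alpha : R), [/\ (0 < m)%N, 0 < alpha <= 1 &
      forall f, (forall y, 0 <= f y) ->
        forall x, V x <= L -> alpha * f z <= iter m K f x]) ->
  exists C kappa : R, [/\ 0 <= C, 0 < kappa &
    forall c u, euler_consistent K q c u ->
      (forall x y, `|u 0 x - u 0 y| <= 1) ->
    forall t : R, 0 < t ->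
      (forall x y, `|u t x - u t y|
        <= C * expR (- (kappa * t)) * (1 + V x + V y)) /\
      (forall (s : R) x, 0 < s -> `|u (t + s) x - u t x|
        <= C * expR (- (kappa * t)) * (1 + 2 * V x + b))].
Proof.
move=> hK V0 g01 b0 hd q0 hirr.
have [C [rho [C0 /andP[r0 r1] hC]]] := harris_theorem hK V0 g01 b0 hd hirr.
have [g0 g1] := andP g01.
have kappa0 : 0 < q * (1 - rho) by rewrite mulr_gt0 // subr_gt0.
exists C, (q * (1 - rho)); split=> // c u hu osc t t0.
set E := expR _; have E0 : 0 < E by exact: expR_gt0.
have W0 x y : 0 <= 1 + V x + V y by rewrite addr_ge0 // addr_ge0.
have hC' x y j : `|iter j K (u 0) x - iter j K (u 0) y|
    <= C * (1 + V x + V y) * rho ^+ j.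
  by rewrite mulrAC; exact: hC.
have step (s : R) n : 0 < s -> (Num.trunc (q * s) <= n)%N ->
    0 <= q * (s / n.+1%:R) <= 1 /\ q * s <= n.+1%:R.
  move=> s0 hn; have qs0 : 0 <= q * s by rewrite mulr_ge0 // ltW.
  have qsn : q * s <= n.+1%:R.
    have := truncn_itv qs0 => /andP[_ /ltW/le_trans]; apply.
    by rewrite ler_nat ltnS.
  split=> //; rewrite mulrA divr_ge0 //=.
  by rewrite ler_pdivrMr ?ltr0n // mul1r.
have decay (s : R) n : 0 < s -> (Num.trunc (q * s) <= n)%N ->
    (1 - q * (s / n.+1%:R) * (1 - rho)) ^+ n.+1
      <= expR (- (q * (1 - rho) * s)).
  move=> s0 hn; have [/andP[p0 p1] _] := step s n s0 hn.
  set p := q * _ in p0 p1 *.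
  have -> : - (q * (1 - rho) * s) = n.+1%:R * (- (p * (1 - rho))).
    by rewrite /p; move: (ltr0Sn R n); move: (n.+1%:R) => m m0; field; rewrite gt_eqF.
  rewrite expRM_natl lerXn2r ?nnegrE ?expR_ge0 //.
    have : p * (1 - rho) <= 1 * 1.
      by rewrite ler_pM ?subr_ge0 // ?lerBlDr ?lerDl ltW.
    by rewrite mul1r subr_ge0.
  exact: expR_ge1Dx.
have close x y : `|u t x - u t y| <= C * E * (1 + V x + V y).
  apply: (@le_of_le_add_div _ _ (2 * (c * t ^+ 2)) (Num.trunc (q * t))) => n hn.
  have [p01 qt] := step t n t0 hn.
  have := euler_approximation hK q0 hu x (lexx 0) t0 qt.
  have := euler_approximation hK q0 hu y (lexx 0) t0 qt.
  have := lazy_geometric p01 hK (hC' x y) n.+1.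
  set L := iter _ _ _; rewrite !add0r => e1 e2 e3.
  have e4 : `|L x - L y| <= C * E * (1 + V x + V y).
    apply: le_trans e1 _; rewrite [X in _ <= X]mulrAC ler_wpM2l ?mulr_ge0 //.
    exact: decay.
  have -> : u t x - u t y = (u t x - L x) + (L x - L y) - (u t y - L y) by ring.
  apply: le_trans (ler_normB _ _) _.
  have := ler_normD (u t x - L x) (L x - L y).
  by move: e2 e3 e4; rewrite -[2 * _ / _]mulrA; set r := _ / _; lra.
split=> // s x s0.
apply: (@le_of_le_add_div _ _ (c * s ^+ 2) (Num.trunc (q * s))) => n hn.
have [p01 qs] := step s n s0 hn.
have := euler_approximation hK q0 hu x (ltW t0) s0 qs.
set p := q * _ in p01 *; set L := iter _ _ => e1.
have hL : markov_operator L by apply/markov_iter/markov_lazy.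
have [p0 p1] := andP p01.
have G01 : 0 <= 1 - p * (1 - g) <= 1.
  have g'0 : 0 <= 1 - g by lra.
  by have := mulr_ge0 p0 g0; have := mulr_ge0 p0 g'0; lra.
suff e2 : `|L (u t) x - u t x| <= C * E * (1 + 2 * V x + b).
  rewrite -(subrKA (L (u t) x)).
  apply: le_trans (ler_normD _ _) _.
  by move: e1 e2; set r := _ / _; lra.
have -> : L (u t) x - u t x = L (fun y => u t y - u t x) x.
  by rewrite (markov_sub hL) (markov_const hL).
apply: le_trans (_ : L (fun y => C * E * (1 + V x + V y)) x <= _).
  by apply: (markov_norm hL) => y; rewrite distrC.
rewrite (markov_scale hL); apply: ler_wpM2l; first by rewrite mulr_ge0 // ltW.
have -> : L (fun y => 1 + V x + V y) x = 1 + V x + L V x.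
  rewrite -[X in _ = X + _](markov_const hL _ x).
  exact: (markov_add hL (fun=> 1 + V x)).
have := drift_iter n.+1 (markov_lazy p01 hK) (proj1 (andP G01)) (drift_lazy p01 hd) x.
rewrite -/L; set G := _ ^+ n.+1.
have G0 : 0 <= G by apply: exprn_ge0; case/andP: G01.
have G1 : G <= 1 by apply: exprn_ile1; case/andP: G01.
have := ler_wpM2r (V0 x) G1; have := mulr_ge0 G0 b0.
by lra.
Qed.

End ContinuousTime.

(** * The generator of the small jump model *)

Section Generator.
Variables (R : realType) (N : nat) (delta lambda : R).
Hypotheses (delta_ge0 : 0 <= delta) (lambda_ge0 : 0 <= lambda).
Implicit Types (x y : N.-tuple nat) (f V : N.-tuple nat -> R) (i k : 'I_N).

Local Notation up := (rate_up delta).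
Local Notation down := (rate_down lambda).

Definition gen f x : R :=
  \sum_(i < N) (up * (f (incr x i) - f x) + down x i * (f (decr x i) - f x)).

Definition below x i : R := N%:R^-1 * \sum_(k < N) (tnth x k < tnth x i)%N%:R.

(** An upper bound for the exit rates.  It is strict, so that the chain
    [jump_chain] has a positive probability to stay where it is. *)
Definition clock : R := N%:R * (2 + delta + lambda) + 1.

(** The discrete chain from which the process is obtained by jumping at the
    times of a Poisson process of rate [clock]. *)
Definition jump_chain f x : R := f x + clock^-1 * gen f x.

Lemma tnth_incr x i j :
  tnth (incr x i) j = if j == i then (tnth x j).+1 else tnth x j.
Proof. by rewrite tnth_mktuple. Qed.

Lemma tnth_decr x i j :
  tnth (decr x i) j = if j == i then (tnth x j).-1 else tnth x j.
Proof. by rewrite tnth_mktuple. Qed.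

Lemma below_sum x i :
  below x i = N%:R^-1 * \sum_(k < N | k != i) (tnth x k < tnth x i)%N%:R.
Proof. by rewrite /below (bigD1 i) //= ltnn add0r. Qed.

Lemma below_ge0 x i : 0 <= below x i.
Proof. by rewrite mulr_ge0 ?invr_ge0 // sumr_ge0. Qed.

Lemma sum_others (c : R) i : \sum_(k < N | k != i) c = c *+ N.-1.
Proof. by rewrite sumr_const (cardC1 i) card_ord. Qed.

Lemma below_le x i : below x i <= N.-1%:R / N%:R.
Proof.
rewrite below_sum mulrC ler_wpM2r ?invr_ge0 //.
rewrite -[leRHS](sum_others 1 i); apply: ler_sum => k _.
by rewrite lern1 leq_b1.
Qed.

Lemma below_le1 x i : below x i <= 1.
Proof.
apply: le_trans (below_le x i) _; case: N i => [[]//|n] _.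
by rewrite ler_pdivrMr ?ltr0n // mul1r ler_nat.
Qed.

Lemma down_succ x i : (0 < tnth x i)%N -> down x i = 1 + lambda * below x i.
Proof. by rewrite /rate_down => ->. Qed.

Lemma down_zero x i : tnth x i = 0%N -> down x i = 0.
Proof. by rewrite /rate_down => ->. Qed.

Lemma down_ge0 x i : 0 <= down x i.
Proof.
rewrite /rate_down; case: ifP => // _.
by rewrite addr_ge0 // mulr_ge0 //; exact: below_ge0.
Qed.

Lemma down_le x i : down x i <= 1 + lambda.
Proof.
rewrite /rate_down; case: ifP => _; last by rewrite addr_ge0.
by rewrite lerD2l -[leRHS]mulr1 ler_wpM2l //; exact: below_le1.
Qed.

Lemma up_ge0 : 0 <= up. Proof. by rewrite addr_ge0. Qed.

Lemma exit_rate_le x : exit_rate delta lambda x <= clock - 1.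
Proof.
rewrite /clock addrK mulr_natl -{2}[N]card_ord -sumr_const.
by apply: ler_sum => i _; rewrite /rate_up; have := down_le x i; lra.
Qed.

Lemma clock_ge1 : 1 <= clock.
Proof. by rewrite lerDr mulr_ge0 // addr_ge0 // addr_ge0. Qed.

Lemma clock_gt0 : 0 < clock.
Proof. exact: lt_le_trans clock_ge1. Qed.

Definition arrivals f x : R :=
  \sum_(i < N) (up * f (incr x i) + down x i * f (decr x i)).

Lemma genE f x : gen f x = arrivals f x - exit_rate delta lambda x * f x.
Proof.
rewrite /gen /arrivals /exit_rate mulr_suml -sumrB.
by apply: eq_bigr => i _; ring.
Qed.

Lemma arrivals_ge0 f x : (forall y, 0 <= f y) -> 0 <= arrivals f x.
Proof.
by move=> f0; apply: sumr_ge0 => i _; rewrite addr_ge0 // mulr_ge0 ?up_ge0 ?down_ge0.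
Qed.

Lemma gen_linear a f h x :
  gen (fun y => a * f y + h y) x = a * gen f x + gen h x.
Proof.
by rewrite /gen mulr_sumr -big_split; apply: eq_bigr => i _ /=; ring.
Qed.

Lemma gen_norm f b x : (forall y, `|f y| <= b) -> `|gen f x| <= 2 * clock * b.
Proof.
move=> fb; have b0 : 0 <= b by apply: le_trans (fb x).
apply: le_trans (ler_norm_sum _ _ _) _.
apply: (@le_trans _ _ (exit_rate delta lambda x * (2 * b))).
  rewrite mulr_suml; apply: ler_sum => i _.
  have diff y : `|f y - f x| <= 2 * b.
    by apply: le_trans (ler_normB _ _) _; have := fb y; have := fb x; lra.
  apply: le_trans (ler_normD _ _) _; rewrite !normrM mulrDl.
  rewrite (ger0_norm up_ge0) (ger0_norm (down_ge0 x i)).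
  by rewrite lerD // ler_wpM2l ?up_ge0 ?down_ge0.
rewrite (mulrC 2 clock) -mulrA ler_wpM2r ?mulr_ge0 //.
by apply: le_trans (exit_rate_le x) _; rewrite lerBlDr lerDl.
Qed.

Lemma jump_chain_ge f x : (forall y, 0 <= f y) ->
  clock^-1 * (f x + arrivals f x) <= jump_chain f x.
Proof.
move=> f0; rewrite /jump_chain genE.
have e : clock^-1 * (clock * f x) = f x by rewrite mulKf // gt_eqF ?clock_gt0.
rewrite -[X in _ <= X + _]e -mulrDr ler_wpM2l ?invr_ge0 ?(ltW clock_gt0) //.
have h : 0 <= clock - 1 - exit_rate delta lambda x.
  by rewrite subr_ge0 exit_rate_le.
by have := mulr_ge0 h (f0 x); lra.
Qed.

Lemma markov_jump_chain : markov_operator jump_chain.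
Proof.
split=> [a f h x|x|f f0 x].
- by rewrite /jump_chain gen_linear; ring.
- rewrite /jump_chain /gen big1 ?mulr0 ?addr0 // => i _.
  by rewrite subrr !mulr0 addr0.
- apply: le_trans (jump_chain_ge x f0).
  by rewrite mulr_ge0 ?invr_ge0 ?(ltW clock_gt0) // addr_ge0 ?arrivals_ge0.
Qed.

Definition origin : N.-tuple nat := [tuple 0%N | _ < N].

(** Downward jumps have rate at least 1 at every positive coordinate, and they
    lead to the origin in as many steps as the sum of the coordinates; the
    chain is free to spend the remaining steps on the spot. *)
Lemma jump_chain_origin m f x : (forall y, 0 <= f y) ->
  (\sum_(i < N) tnth x i <= m)%N ->
  clock^-1 ^+ m * f origin <= iter m jump_chain f x.
Proof.
move=> f0; have ci : 0 <= clock^-1 by rewrite invr_ge0 (ltW clock_gt0).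
elim: m x => [|m IH] x hx.
  rewrite expr0 mul1r /=; suff -> : x = origin by [].
  apply: eq_from_tnth => i; rewrite tnth_mktuple; apply/eqP.
  by rewrite -leqn0 (leq_trans _ hx) // (bigD1 i) //= leq_addr.
have h0 y : 0 <= iter m jump_chain f y.
  exact: (markov_ge0 (markov_iter markov_jump_chain m)).
rewrite iterS exprS -mulrA; apply: le_trans (jump_chain_ge x h0).
rewrite ler_wpM2l //.
case: (boolP [exists i, 0 < tnth x i]%N) => [/existsP[i xi]|].
  have /IH le_i : (\sum_(j < N) tnth (decr x i) j <= m)%N.
    rewrite -ltnS; apply: leq_trans hx.
    rewrite (bigD1 i) //= [ltnRHS](bigD1 i) //= tnth_decr eqxx.
    rewrite (eq_bigr (tnth x)) => [|j /negPf ji]; last by rewrite tnth_decr ji.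
    by rewrite ltn_add2r prednK.
  apply: le_trans le_i _; set h := iter _ _ _ in h0 *.
  rewrite /arrivals (bigD1 i) //= down_succ // addrA.
  apply: ler_wpDr.
    by apply: sumr_ge0 => j _; rewrite addr_ge0 // mulr_ge0 ?up_ge0 ?down_ge0.
  have := mulr_ge0 up_ge0 (h0 (incr x i)); have := h0 x.
  have := mulr_ge0 (mulr_ge0 lambda_ge0 (below_ge0 x i)) (h0 (decr x i)).
  by lra.
rewrite negb_exists => /forallP x0.
apply: le_trans (IH x _) _; last by rewrite lerDl arrivals_ge0.
by rewrite big1 // => i _; have := x0 i; rewrite -eqn0Ngt => /eqP.
Qed.

Lemma gen_coordinate (phi : nat -> R) i x :
  gen (fun y => phi (tnth y i)) x =
    up * (phi (tnth x i).+1 - phi (tnth x i))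
    + down x i * (phi (tnth x i).-1 - phi (tnth x i)).
Proof.
rewrite /gen (bigD1 i) //= big1 ?addr0 => [|j ji].
  by rewrite tnth_incr tnth_decr eqxx.
by rewrite tnth_incr tnth_decr eq_sym (negPf ji) subrr !mulr0 addr0.
Qed.

Lemma gen_two_coordinates (psi : nat -> nat -> R) i k x : k != i ->
  gen (fun y => psi (tnth y i) (tnth y k)) x =
    let m := tnth x i in let n := tnth x k in
    up * (psi m.+1 n - psi m n) + down x i * (psi m.-1 n - psi m n)
    + (up * (psi m n.+1 - psi m n) + down x k * (psi m n.-1 - psi m n)).
Proof.
move=> ki; rewrite /gen (bigD1 i) //= (bigD1 k) //= big1 ?addr0.
  by rewrite !tnth_incr !tnth_decr !eqxx (eq_sym i) (negPf ki).
move=> j /andP[ji jk]; rewrite !tnth_incr !tnth_decr.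
by rewrite eq_sym (negPf ji) eq_sym (negPf jk) subrr !mulr0 addr0.
Qed.

End Generator.

(** * A Lyapunov function *)

Lemma sum_pairs_le (R : realType) (N : nat) (F G : 'I_N -> 'I_N -> R) :
    (forall i k, k != i -> F i k + F k i <= G i k + G k i) ->
  \sum_(i < N) \sum_(k < N | k != i) F i k
    <= \sum_(i < N) \sum_(k < N | k != i) G i k.
Proof.
move=> FG.
have swap (H : 'I_N -> 'I_N -> R) : \sum_(i < N) \sum_(k < N | k != i) H i k
    = 2^-1 * \sum_(i < N) \sum_(k < N | k != i) (H i k + H k i).
  have e : \sum_(i < N) \sum_(k < N | k != i) H k i
      = \sum_(i < N) \sum_(k < N | k != i) H i k.
    rewrite (exchange_big_dep predT) //=; apply: eq_bigr => k _.
    by apply: eq_bigl => i; rewrite eq_sym.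
  under [in RHS]eq_bigr do rewrite big_split /=.
  by rewrite big_split /= e; set Z := \sum_(i < N) _; lra.
rewrite swap [leRHS]swap ler_wpM2l ?invr_ge0 //.
by apply: ler_sum => i _; apply: ler_sum => k ki; exact: FG.
Qed.

(** Here [mu] stands for [lambda * (N - 1) / N], which is at least
    [lambda / 2].  The condition on [mu] is what is needed for the existence of
    a weight [kappa] of the ties and of a rate [eta] that make the
    contributions of tied pairs and of untied pairs negative. *)
Lemma lyapunov_parameters (R : realType) (delta mu : R) :
    0 <= delta -> 6 * delta + 3 * delta ^+ 2 < 2 * mu ->
  exists kappa eta : R, [/\ 0 <= kappa, 0 < eta,
    delta + eta <= kappa * (2 + delta) &
    2 * (delta + eta) + kappa * (2 + delta + mu) <= mu].
Proof.
move=> d0 h; have d2 : 0 <= delta ^+ 2 by rewrite exprn_ge0.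
have mu0 : 0 < mu by lra.
(* With [kappa * (2 + delta) = delta + eta], the last condition is linear in
   [eta], and [eta] is its largest solution. *)
pose D := 6 + 3 * delta + mu; have D0 : 0 < D by rewrite /D; lra.
pose eta := (2 * mu - 6 * delta - 3 * delta ^+ 2) / D.
have etaD : eta * D = 2 * mu - 6 * delta - 3 * delta ^+ 2.
  by rewrite /eta mulfVK // gt_eqF.
have eta0 : 0 < eta by rewrite divr_gt0 //; lra.
have e0 : 0 < 2 + delta by lra.
pose kappa := (delta + eta) / (2 + delta).
have kappaE : kappa * (2 + delta) = delta + eta.
  by rewrite /kappa mulfVK // gt_eqF.
exists kappa, eta; split => //.
- by rewrite divr_ge0 //; lra.
- by rewrite kappaE.
rewrite -(ler_pM2r e0).
have := congr1 (fun v => v * (2 + delta + mu)) kappaE.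
by move: etaD; rewrite /D /=; lra.
Qed.

Section Lyapunov.
Variables (R : realType) (N : nat) (delta lambda : R).
Hypotheses (delta_ge0 : 0 <= delta) (lambda_ge0 : 0 <= lambda).
Variable s : R.
Hypothesis s_ge0 : 0 <= s.
Implicit Types (x y : N.-tuple nat) (i k : 'I_N).

Local Notation up := (rate_up delta).
Local Notation down := (rate_down lambda).
Local Notation gen := (gen delta lambda).
Local Notation below := (below R).

Definition height x i : R := (1 + s) ^+ tnth x i.

Definition tie x i k : R := (tnth x i == tnth x k)%:R * height x i.

Lemma height_ge0 x i : 0 <= height x i.
Proof. by rewrite exprn_ge0 // addr_ge0. Qed.

Lemma tie_ge0 x i k : 0 <= tie x i k.
Proof. by rewrite mulr_ge0 // height_ge0. Qed.

Lemma tie_le x i k : tie x i k <= height x i.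
Proof. by rewrite /tie; case: eqP => _; rewrite ?mul1r ?mul0r ?height_ge0. Qed.

(** The first-order drift is [delta - lambda * below x i]; the last term
    accounts for the missing downward jumps at 0. *)
Lemma gen_height x i : gen (fun y => height y i) x <=
  height x i * (s * (delta - lambda * below x i) + s ^+ 2 * (1 + lambda)) + s.
Proof.
have b0 := below_ge0 R x i; have b1 := below_le1 R x i.
rewrite (gen_coordinate _ _ (fun n => (1 + s) ^+ n)) /height /rate_up.
case E : (tnth x i) => [|n] /=.
  have -> : below x i = 0.
    rewrite /below big1 ?mulr0 // => k _; by rewrite E ltn0.
  rewrite down_zero // expr0 expr1 mulr0.
  have := mulr_ge0 (exprn_ge0 2 s_ge0) (addr_ge0 ler01 lambda_ge0).
  by have := s_ge0; lra.
rewrite down_succ ?E // (exprS _ n.+1) (exprS _ n); set P := (1 + s) ^+ n.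
have P0 : 0 <= P by rewrite exprn_ge0 // addr_ge0.
have s2 : 0 <= s ^+ 2 * P by rewrite mulr_ge0 // exprn_ge0.
have lb : 0 <= lambda - lambda * below x i.
  by rewrite -[X in X - _]mulr1 -mulrBr mulr_ge0 // subr_ge0.
have := mulr_ge0 s2 lb; have := mulr_ge0 (mulr_ge0 s2 s_ge0) (addr_ge0 ler01 lambda_ge0).
by have := s_ge0; lra.
Qed.

(** Any jump of two tied particles breaks the tie, while a tie can be created
    by a jump up of the lower particle or a jump down of the upper one.  The
    constant [4 + 2 * delta] compensates for the first term when the tie is at 0,
    where the height is 1 and there are no downward jumps. *)
Definition tie_drift x i k : R :=
  if tnth x i == tnth x k then - ((4 + 2 * delta) * height x i) + (4 + 2 * delta)
  else (2 + delta + lambda * (N.-1%:R / N%:R))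
    * Num.max (height x i) (height x k).

Lemma gen_tie x i k : k != i -> gen (fun y => tie y i k) x <= tie_drift x i k.
Proof.
move=> ki.
rewrite (gen_two_coordinates _ _ (fun m n => (m == n)%:R * (1 + s) ^+ m)) //=.
have lb j : lambda * below x j <= lambda * (N.-1%:R / N%:R).
  by rewrite ler_wpM2l // below_le.
have lb0 j : 0 <= lambda * below x j by rewrite mulr_ge0 // below_ge0.
rewrite /tie_drift /height /rate_up.
have Pm m : 0 <= (1 + s) ^+ m by rewrite exprn_ge0 // addr_ge0.
have mono m n : (m <= n)%N -> (1 + s) ^+ m <= (1 + s) ^+ n.
  by move=> mn; apply: ler_weXn2l => //; rewrite lerDl.
have ind (c : bool) m n : (m <= n)%N -> 0 <= c%:R * (1 + s) ^+ m <= (1 + s) ^+ n.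
  by move=> /mono mn; case: c; rewrite ?mul1r ?mul0r ?lexx ?Pm.
case: (ltngtP (tnth x i) (tnth x k)) => [lt_ik|lt_ki|eq_ik].
- rewrite !mul0r !subr0.
  have -> : (tnth x i).-1 == tnth x k = false.
    by rewrite ltn_eqF // (leq_ltn_trans (leq_pred _) lt_ik).
  have -> : tnth x i == (tnth x k).+1 = false by rewrite ltn_eqF // ltnW.
  rewrite !mul0r !mulr0 addr0 add0r.
  rewrite down_succ ?(leq_ltn_trans _ lt_ik) //.
  rewrite max_r ?(mono _ _ (ltnW lt_ik)) //.
  have /andP[_ h1] := ind ((tnth x i).+1 == tnth x k) _ _ lt_ik.
  have /andP[_ h2] := ind (tnth x i == (tnth x k).-1) _ _ (ltnW lt_ik).
  have d1 : 0 <= 1 + delta by rewrite addr_ge0.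
  have b1 : 0 <= 1 + lambda * below x k by rewrite addr_ge0.
  have := ler_wpM2l d1 h1; have := ler_wpM2l b1 h2.
  by have := ler_wpM2r (Pm (tnth x k)) (lb k); lra.
- rewrite !mul0r !subr0.
  have -> : (tnth x i).+1 == tnth x k = false by rewrite gtn_eqF // ltnW.
  have -> : tnth x i == (tnth x k).-1 = false.
    by rewrite gtn_eqF // (leq_ltn_trans (leq_pred _) lt_ki).
  rewrite !mul0r !mulr0 addr0 add0r.
  rewrite down_succ ?(leq_ltn_trans _ lt_ki) //.
  rewrite max_l ?(mono _ _ (ltnW lt_ki)) //.
  have /andP[_ h1] := ind (tnth x i == (tnth x k).+1) _ _ (leqnn (tnth x i)).
  have /andP[_ h2] := ind ((tnth x i).-1 == tnth x k) _ _ (leq_pred (tnth x i)).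
  have d1 : 0 <= 1 + delta by rewrite addr_ge0.
  have b1 : 0 <= 1 + lambda * below x i by rewrite addr_ge0.
  have := ler_wpM2l d1 h1; have := ler_wpM2l b1 h2.
  by have := ler_wpM2r (Pm (tnth x i)) (lb i); lra.
rewrite -eq_ik !mul1r.
have -> : (tnth x i).+1 == tnth x i = false by rewrite gtn_eqF.
have -> : tnth x i == (tnth x i).+1 = false by rewrite ltn_eqF.
rewrite !mul0r !sub0r.
case E : (tnth x i) => [|n].
  rewrite !down_zero -?eq_ik // expr0; have := delta_ge0; lra.
rewrite !down_succ -?eq_ik ?E //=.
have -> : n == n.+1 = false by rewrite ltn_eqF.
have -> : n.+1 == n = false by rewrite gtn_eqF.
rewrite !mul0r.
have := mulr_ge0 (lb0 i) (Pm n.+1); have := mulr_ge0 (lb0 k) (Pm n.+1).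
by have := delta_ge0; lra.
Qed.

End Lyapunov.

Lemma gen_sum (R : realType) (N : nat) (delta lambda : R) (I : Type)
    (r : seq I) (P : pred I) (F : I -> N.-tuple nat -> R) x :
  gen delta lambda (fun y => \sum_(j <- r | P j) F j y) x
    = \sum_(j <- r | P j) gen delta lambda (F j) x.
Proof.
rewrite /gen [RHS]exchange_big /=; apply: eq_bigr => i _.
by rewrite -!sumrB !mulr_sumr -big_split.
Qed.

Section LyapunovDrift.
Variables (R : realType) (N : nat) (delta lambda : R).
Hypotheses (delta_ge0 : 0 <= delta) (lambda_ge0 : 0 <= lambda).
Implicit Types (x y : N.-tuple nat) (i k : 'I_N).

(** The drift of each particle is shared out between the pairs to which it
    belongs; [d'], [e'] and [l'] are the shares of [delta], of the rate of
    decay, and of [lambda].  In an untied pair, only the upper particle is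
    pulled down by the other one, but it also has the larger weight. *)
Lemma pair_drift (s d' e' l' c : R) x i k : 0 <= s ->
    0 <= d' -> 0 <= e' -> 0 <= c -> d' + e' <= c * (4 + 2 * delta) ->
    2 * (d' + e') + 2 * c * (2 + delta + lambda * (N.-1%:R / N%:R)) <= l' ->
  let F i k := height s x i * d'
    - l' * ((tnth x k < tnth x i)%N%:R * height s x i)
    + c * tie_drift delta lambda s x i k in
  let G i := - (e' * height s x i) + c * (4 + 2 * delta) in
  F i k + F k i <= G i + G k.
Proof.
move=> s0 d0 e0 c0 tied untied; rewrite /tie_drift /=.
have cd0 : 0 <= c * (4 + 2 * delta) by apply: le_trans tied; rewrite addr_ge0.
have hh0 j := height_ge0 s0 x j.
have mono j l : (tnth x j < tnth x l)%N -> height s x j <= height s x l.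
  by move=> /ltnW jl; apply: ler_weXn2l => //; rewrite lerDl.
case: (ltngtP (tnth x i) (tnth x k)) => [/mono h|/mono h|e].
- rewrite (max_r h) (max_l h) mul0r mul1r.
  have h1 : 0 <= height s x k - height s x i by rewrite subr_ge0.
  have := mulr_ge0 (addr_ge0 d0 e0) h1; have := ler_wpM2r (hh0 k) untied.
  by lra.
- rewrite (max_l h) (max_r h) mul0r mul1r.
  have h1 : 0 <= height s x i - height s x k by rewrite subr_ge0.
  have := mulr_ge0 (addr_ge0 d0 e0) h1; have := ler_wpM2r (hh0 i) untied.
  by lra.
have -> : height s x k = height s x i by rewrite /height e.
by have := ler_wpM2r (hh0 i) tied; rewrite mul0r; lra.
Qed.

(** The function is the sum of the exponentials [(1 + s) ^+ x_i] of the
    positions, corrected at first order in [s] by the ties, which have to be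
    counted because no particle of a tied pair is pulled down by the other. *)
Theorem lyapunov_function : (2 <= N)%N ->
    6 * delta + 3 * delta ^+ 2 < lambda ->
  exists (V : N.-tuple nat -> R) (s theta b : R),
    [/\ 0 < s, 0 < theta <= 1, 0 <= b,
      forall x, s * (\sum_(i < N) tnth x i)%N%:R <= V x &
      forall x, gen delta lambda V x <= theta * (b - V x)].
Proof.
move=> N2 hl; set n1 : R := N.-1%:R; set mu := lambda * (n1 / N%:R).
have n1_gt0 : 0 < n1 by rewrite ltr0n; case: N N2 => [|[]].
have N_gt0 : 0 < N%:R :> R by rewrite ltr0n ltnW.
have l0 : 0 < lambda.
  by apply: le_lt_trans hl; rewrite addr_ge0 // mulr_ge0 // exprn_ge0.
have half_mu : lambda <= 2 * mu.
  rewrite /mu mulrCA ler_peMr // mulrA ler_pdivlMr // mul1r -natrM ler_nat.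
  by case: N N2 => [|[|n]] // _; rewrite mul2n -addnn addnS ltnS leq_addr.
have [kappa [eta [kappa0 eta0 tied untied]]] :=
  lyapunov_parameters delta_ge0 (lt_le_trans hl half_mu).
(* Half of the rate [eta] is given up to absorb the terms of second order. *)
pose s := eta / (2 * (1 + lambda)).
have s0 : 0 < s by rewrite divr_gt0 // mulr_gt0 // addr_gt0.
have sE : s * (1 + lambda) = eta / 2.
  have l1 : 0 < 1 + lambda by rewrite addr_gt0.
  by rewrite /s; field; rewrite gt_eqF.
(* Every tie is counted twice in [T] below, and the drift of a particle is shared
   out between [N - 1] pairs. *)
pose c := kappa / (2 * n1).
have c0 : 0 <= c by rewrite divr_ge0 // mulr_ge0 // ltW.
have cE : 2 * c * n1 = kappa by rewrite /c; field; rewrite gt_eqF.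
pose H x := \sum_(i < N) height s x i.
pose T x := \sum_(i < N) \sum_(k < N | k != i) tie s x i k.
pose V x := H x + s * c * T x.
have H0 x : 0 <= H x by apply: sumr_ge0 => i _; exact: height_ge0 (ltW s0) _ _.
have T0 x : 0 <= T x.
  apply: sumr_ge0 => i _; apply: sumr_ge0 => k _.
  exact: tie_ge0 (ltW s0) _ _ _.
have T_le x : T x <= n1 * H x.
  rewrite mulr_sumr; apply: ler_sum => i _.
  rewrite mulr_natl -(sum_others _ i).
  by apply: ler_sum => k _; exact: tie_le (ltW s0) _ _ _.
have sc0 : 0 <= s * c by rewrite mulr_ge0 // ltW.
have V_le x : V x <= (1 + s * kappa / 2) * H x.
  have := ler_wpM2l sc0 (T_le x).
  by rewrite /V -cE; lra.
have V_ge x : H x <= V x by rewrite lerDl mulr_ge0.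
pose B := N%:R * n1 * (c * (4 + 2 * delta)) + N%:R.
have B0 : 0 <= B.
  rewrite /B; apply: addr_ge0; last exact: ltW.
  apply: mulr_ge0; first by rewrite mulr_ge0 // ltW.
  by apply: mulr_ge0 => //; have := delta_ge0; lra.
have gen_V x : gen delta lambda V x <= s * (B - eta / 2 * H x).
  have genVE : gen delta lambda V x =
      \sum_(i < N) gen delta lambda (fun y => height s y i) x + s * c *
      \sum_(i < N) \sum_(k < N | k != i) gen delta lambda (fun y => tie s y i k) x.
    have -> : V = (fun y => s * c * T y + H y) by apply: funext => y; rewrite addrC.
    rewrite gen_linear addrC /H /T !gen_sum; congr (_ + _ * _).
    by apply: eq_bigr => i _; rewrite gen_sum.
  rewrite genVE.
  pose F i k := height s x i * (delta / n1)
    - lambda / N%:R * ((tnth x k < tnth x i)%N%:R * height s x i)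
    + c * tie_drift delta lambda s x i k.
  pose G i := - (eta / n1 * height s x i) + c * (4 + 2 * delta).
  have share i : height s x i * (delta - lambda * below R x i)
      = \sum_(k < N | k != i) (height s x i * (delta / n1)
          - lambda / N%:R * ((tnth x k < tnth x i)%N%:R * height s x i)).
    rewrite sumrB sum_others -mulr_sumr -mulr_suml below_sum -mulr_natl -/n1.
    by set Z := \sum_(k < N | _) _; field; rewrite !gt_eqF.
  have FG : \sum_(i < N) \sum_(k < N | k != i) F i k
      <= \sum_(i < N) \sum_(k < N | k != i) G i.
    apply: (sum_pairs_le (G := fun i _ => G i)) => i k _.
    have d'0 : 0 <= delta / n1 by rewrite divr_ge0 // ltW.
    have e'0 : 0 <= eta / n1 by rewrite divr_ge0 // ltW.
    apply: (pair_drift x i k (ltW s0) d'0 e'0 c0).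
      rewrite -mulrDl ler_pdivrMr //.
      by apply: le_trans tied _; rewrite -cE; lra.
    rewrite -/n1 -/mu -(ler_pM2r n1_gt0).
    have -> : lambda / N%:R * n1 = mu by rewrite /mu; ring.
    apply: le_trans untied; rewrite -cE le_eqVlt; apply/orP; left; apply/eqP.
    by field; rewrite gt_eqF.
  have GE : \sum_(i < N) \sum_(k < N | k != i) G i = B - N%:R - eta * H x.
    rewrite (eq_bigr (fun i => - (eta * height s x i) + n1 * (c * (4 + 2 * delta)))).
      rewrite big_split /= sumrN -mulr_sumr sumr_const card_ord -mulr_natl -/(H x).
      by rewrite /B; ring.
    move=> i _; rewrite sum_others -mulr_natl -/n1 /G.
    by field; rewrite gt_eqF.
  have sumF : \sum_(i < N) height s x i * (delta - lambda * below R x i)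
      + c * \sum_(i < N) \sum_(k < N | k != i) tie_drift delta lambda s x i k
      = \sum_(i < N) \sum_(k < N | k != i) F i k.
    rewrite mulr_sumr -big_split; apply: eq_bigr => i _ /=.
    by rewrite share mulr_sumr -big_split.
  have hei : \sum_(i < N) gen delta lambda (fun y => height s y i) x
      <= s * (\sum_(i < N) height s x i * (delta - lambda * below R x i))
         + s * (eta / 2 * H x) + s * N%:R.
    apply: (@le_trans _ _ (\sum_(i < N) (height s x i *
      (s * (delta - lambda * below R x i) + s ^+ 2 * (1 + lambda)) + s))).
      by apply: ler_sum => i _; exact: gen_height (ltW s0) _ _.
    rewrite big_split /= sumr_const card_ord -[s *+ N]mulr_natr lerD2r.
    rewrite /H !mulr_sumr -big_split le_eqVlt; apply/orP; left; apply/eqP.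
    by apply: eq_bigr => i _ /=; rewrite -sE; ring.
  have tei : s * c * \sum_(i < N) \sum_(k < N | k != i) gen delta lambda
        (fun y => tie s y i k) x
      <= s * (c * \sum_(i < N) \sum_(k < N | k != i) tie_drift delta lambda s x i k).
    rewrite -mulrA !(ler_wpM2l (ltW s0)) // ler_wpM2l //.
    apply: ler_sum => i _; apply: ler_sum => k ki.
    by apply: gen_tie => //; exact: ltW.
  apply: le_trans (lerD hei tei) _.
  move: FG; rewrite -sumF GE => /(ler_wpM2l (ltW s0)).
  by lra.
pose theta := Num.min 1 (s * (eta / 2) / (1 + s * kappa / 2)).
have D0 : 0 < 1 + s * kappa / 2.
  by rewrite ltr_pwDl // divr_ge0 // mulr_ge0 // ltW.
have theta0 : 0 < theta.
  by rewrite lt_min ltr01 divr_gt0 // mulr_gt0 // divr_gt0.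
exists V, s, theta, (s * B / theta); split => //.
- by rewrite theta0 ge_min lexx.
- apply: divr_ge0; [apply: mulr_ge0 => // | ]; exact: ltW.
- move=> x; apply: le_trans (V_ge x); rewrite natr_sum mulr_sumr.
  apply: ler_sum => i _; rewrite /height.
  elim: (tnth x i) => [|n IH]; first by rewrite mulr0.
  rewrite exprS -natr1; have : 1 <= (1 + s) ^+ n by apply: exprn_ege1; rewrite lerDl ltW.
  by rewrite -subr_ge0 => /(mulr_ge0 (ltW s0)); move: IH; lra.
move=> x; apply: le_trans (gen_V x) _.
have thetaV : theta * V x <= s * (eta / 2) * H x.
  apply: (@le_trans _ _ (theta * ((1 + s * kappa / 2) * H x))).
    by rewrite ler_wpM2l // ltW.
  by rewrite [leLHS]mulrA ler_wpM2r // -ler_pdivlMr // ge_min lexx orbT.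
have thetaB : theta * (s * B / theta) = s * B by rewrite mulrC mulfVK // gt_eqF.
by rewrite [leRHS]mulrBr thetaB; lra.
Qed.

End LyapunovDrift.

(** * The transition probabilities *)

Section Measurability.
Context {N : nat}.
Implicit Types (x y z : N.-tuple nat) (A : set (N.-tuple nat)).

Lemma measurable_states A : measurable A.
Proof.
apply: countable_measurable => [x|]; last exact: countableP.
have -> : [set x] = \bigcap_(i in [set: 'I_N]) ((fun y => tnth y i) @^-1` [set tnth x i]).
  apply/seteqP; split=> [y -> //|y /= xy].
  by apply: eq_from_tnth => i; exact: xy.
apply: fin_bigcap_measurable => // i _.
by rewrite -[_ @^-1` _]setTI; exact: measurable_tnth.
Qed.

Lemma measurable_event d (Omega : measurableType d)
  (Z : {mfun Omega >-> N.-tuple nat}) A : measurable (Z @^-1` A).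
Proof. exact: measurable_funPTI (measurable_states A). Qed.

(** The states being countably many, a proportionality between measures need
    only be checked on the fibres of single states. *)
Lemma measure_fibres (R : realType) d (Omega : measurableType d)
    (mu nu : {measure set Omega -> \bar R}) (Z Z' : {mfun Omega >-> N.-tuple nat})
    (E : set Omega) (c : R) A : measurable E -> 0 <= c ->
  (forall z, mu (E `&` Z @^-1` [set z]) = (c%:E * nu (Z' @^-1` [set z]))%E) ->
  mu (E `&` Z @^-1` A) = (c%:E * nu (Z' @^-1` A))%E.
Proof.
move=> mE c0 h.
pose B n := [set y | A y /\ pickle y = n].
have AE : A = \bigcup_n B n.
  by apply/seteqP; split=> [y Ay|y [n _ []] //]; exists (pickle y).
have B1 n : mu (E `&` Z @^-1` B n) = (c%:E * nu (Z' @^-1` B n))%E.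
  have [[y [Ay ny]]|no] := pselect (exists y, A y /\ pickle y = n).
    suff -> : B n = [set y] by exact: h.
    apply/seteqP; split=> [z /= [_ zn]|_ -> //].
    by apply: (pcan_inj pickleK); rewrite zn ny.
  have -> : B n = set0 by apply/seteqP; split=> // z Bz; case: no; exists z.
  by rewrite !preimage_set0 setI0 !measure0 mule0.
have tB : trivIset setT B by move=> i j _ _ [y [[_ <-] [_ <-]]].
rewrite AE !preimage_bigcup setI_bigcupr measure_semi_bigcup.
- rewrite measure_semi_bigcup.
  + rewrite -nneseriesZl //; apply: eq_eseriesr => n _; exact: B1.
  + by move=> n; exact: measurable_event.
  + by move=> i j _ _ [w [/= wi wj]]; apply: tB => //; exists (Z' w).
  + by rewrite -preimage_bigcup; exact: measurable_event.
- by move=> n; apply: measurableI => //; exact: measurable_event.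
- by move=> i j _ _ [w [/= [_ wi] [_ wj]]]; apply: tB => //; exists (Z w).
- rewrite -setI_bigcupr -preimage_bigcup; apply: measurableI => //.
  exact: measurable_event.
Qed.

End Measurability.

Section RealProbability.
Context {R : realType} {d : measure_display} {Omega : measurableType d}.
Variable P : probability Omega R.
Implicit Types E F : set Omega.

Lemma fineP_ge0 E : 0 <= fine (P E).
Proof. exact: fine_ge0. Qed.

Lemma fineP_EFin E : measurable E -> (fine (P E))%:E = P E.
Proof. by move=> mE; rewrite fineK // fin_num_measure. Qed.

Lemma fineP_le1 E : measurable E -> fine (P E) <= 1.
Proof. by move=> mE; rewrite -lee_fin fineP_EFin // probability_le1. Qed.

Lemma fineP_le E F : measurable E -> measurable F -> E `<=` F ->
  fine (P E) <= fine (P F).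
Proof.
by move=> mE mF EF; rewrite -lee_fin !fineP_EFin // le_measure ?inE.
Qed.

Lemma finePU E F : measurable E -> measurable F -> E `&` F = set0 ->
  fine (P (E `|` F)) = fine (P E) + fine (P F).
Proof.
by move=> mE mF EF; rewrite measureU // fineD // fin_num_measure.
Qed.

Lemma fineP_split N (Z : {mfun Omega >-> N.-tuple nat}) (s : seq (N.-tuple nat)) E :
    uniq s -> measurable E ->
  fine (P E) = \sum_(y <- s) fine (P (Z @^-1` [set y] `&` E))
    + fine (P (E `\` Z @^-1` [set` s])).
Proof.
elim: s => [|z s IH] /=.
  move=> _ mE; rewrite big_nil add0r; congr (fine (P _)).
  by apply/seteqP; split=> [w Ew|w []].
move=> /andP[zs us] mE; rewrite IH // big_cons -addrA addrCA; congr (_ + _).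
rewrite -finePU.
- congr (fine (P _)); apply/seteqP; split=> [w [Ew nw]|w].
    have [Zw|Zw] := eqVneq (Z w) z; [left|right] => //; split=> //=.
    by rewrite inE (negPf Zw).
  case=> [[/= Zw Ew]|[Ew /= nw]]; split=> //=; first by rewrite Zw; exact/negP.
  by move=> Zs; apply: nw; rewrite inE Zs orbT.
- by apply: measurableI => //; exact: measurable_event.
- by apply: measurableD => //; exact: measurable_event.
- apply/seteqP; split=> // w [[/= Zw _] [_ nw]]; apply: nw => /=.
  by rewrite Zw inE eqxx.
Qed.

End RealProbability.

Section Process.
Variables (R : realType) (N : nat) (delta lambda : R).
Variables (d : measure_display) (Omega : measurableType d).
Variables (P : N.-tuple nat -> probability Omega R).
Variables (X : R -> {mfun Omega >-> N.-tuple nat}).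
Hypotheses (delta_ge0 : 0 <= delta) (lambda_ge0 : 0 <= lambda).
Hypothesis hX : small_jump_model delta lambda P X.
Implicit Types (x y z : N.-tuple nat) (A : set (N.-tuple nat)) (t h : R).

Local Notation clock := (clock N delta lambda).
Local Notation gen := (gen delta lambda).
Local Notation qmatrix := (qmatrix delta lambda).

Definition trans A t x : R := fine (P x (X t @^-1` A)).

Lemma trans_ge0 A t x : 0 <= trans A t x.
Proof. exact: fineP_ge0. Qed.

Lemma trans_le1 A t x : trans A t x <= 1.
Proof. by apply: fineP_le1; exact: measurable_event. Qed.

Lemma trans_EFin A t x : (trans A t x)%:E = P x (X t @^-1` A).
Proof. by rewrite fineP_EFin //; exact: measurable_event. Qed.

Lemma trans_start x : trans [set x] 0 x = 1.
Proof. by rewrite /trans (sjm_start hX). Qed.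

Lemma trans_markov A h t x y : 0 <= h -> 0 <= t ->
  fine (P x (X h @^-1` [set y] `&` X (h + t) @^-1` A))
    = trans [set y] h x * trans A t y.
Proof.
move=> h0 t0.
suff -> : P x (X h @^-1` [set y] `&` X (h + t) @^-1` A)
    = ((trans [set y] h x)%:E * P y (X t @^-1` A))%E.
  by rewrite -trans_EFin.
apply: measure_fibres => [||z]; [exact: measurable_event|exact: trans_ge0|].
pose tm k : R := if k is 0%N then h else h + t.
pose st k := if k is 0%N then y else z.
have tm_nd : nondecreasing_seq tm.
  by move=> [|i] [|j] //= _; rewrite lerDl.
have := sjm_markov hX x 0 (t := tm) st h0 tm_nd.
rewrite !bigcap_mkord !big_ord_recr !big_ord0 /= !setTI.
by rewrite (addrC h) addrK (addrC t) trans_EFin.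
Qed.

(** The Markov property is applied at time [h] on the finitely many states of
    [s] only: the contribution of the other ones is at most the probability of
    being there.  This spares all the infinite sums of the Chapman-Kolmogorov
    equation. *)
Lemma trans_step s A h t x : uniq s -> 0 <= h -> 0 <= t ->
  0 <= trans A (h + t) x - \sum_(y <- s) trans [set y] h x * trans A t y
    <= 1 - \sum_(y <- s) trans [set y] h x.
Proof.
move=> us h0 t0.
have mA : measurable (X (h + t) @^-1` A) by exact: measurable_event.
have ms : measurable (X h @^-1` [set` s]) by exact: measurable_event.
have -> : trans A (h + t) x = \sum_(y <- s) trans [set y] h x * trans A t y
    + fine (P x (X (h + t) @^-1` A `\` X h @^-1` [set` s])).
  rewrite {1}/trans (fineP_split (P x) (X h) us mA); congr (_ + _).
  by apply: eq_bigr => y _; exact: trans_markov.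
rewrite addrAC subrr add0r fineP_ge0 /=.
have := fineP_split (P x) (X h) us (@measurableT _ Omega).
rewrite probability_setT /=.
rewrite (eq_bigr (fun y => trans [set y] h x)); last first.
  by move=> y _; rewrite setIT.
move=> ->; rewrite addrAC subrr add0r.
apply: fineP_le; [exact: measurableD|exact: measurableD|].
by move=> w [_ nw]; split.
Qed.

Lemma trans_add_ge h t x : 0 <= h -> 0 <= t ->
  trans [set x] h x * trans [set x] t x <= trans [set x] (h + t) x.
Proof.
move=> h0 t0; have /andP[+ _] := trans_step [set x] x (isT : uniq [:: x]) h0 t0.
by rewrite big_seq1 subr_ge0.
Qed.

(** The two probabilities can differ only through the paths that are not at [x]
    at time [h]. *)
Lemma trans_lipschitz_stay A h t x : 0 <= h -> 0 <= t ->
  `|trans A (h + t) x - trans A t x| <= 1 - trans [set x] h x.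
Proof.
move=> h0 t0; have /andP[] := trans_step A x (isT : uniq [:: x]) h0 t0.
rewrite !big_seq1 ler_norml.
have p1 := trans_le1 [set x] h x; have p0 := trans_ge0 [set x] h x.
have u1 := trans_le1 A t x; have u0 := trans_ge0 A t x.
have q0 : 0 <= 1 - trans [set x] h x by rewrite subr_ge0.
have := mulr_ge0 q0 u0.
have u1' : 0 <= 1 - trans A t x by rewrite subr_ge0.
have := mulr_ge0 q0 u1'.
by move=> ? ? ? ?; apply/andP; split; lra.
Qed.

Lemma near0_interval (Q : R -> Prop) : (\forall h \near 0^'+, Q h) ->
  exists2 e : R, 0 < e & forall h, 0 < h < e -> Q h.
Proof.
case=> e /= e0 H; exists e => // h /andP[h0 he]; apply: H => //=.
by rewrite sub0r normrN gtr0_norm.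
Qed.

Lemma trans_rates x y :
  h^-1 * (trans [set y] h x - (y == x)%:R) @[h --> 0^'+] --> qmatrix x y.
Proof. exact: (sjm_rates hX). Qed.

(** The diagonal transition probabilities are supermultiplicative in time,
    which extends to all times the lower bound given by the exit rate for small
    times. *)
Lemma trans_stay x h : 0 <= h -> 1 - clock * h <= trans [set x] h x.
Proof.
have c0 := clock_gt0 N delta_ge0 lambda_ge0.
have [e e0 small] : exists2 e : R, 0 < e &
    forall t, 0 < t < e -> 1 - clock * t <= trans [set x] t x.
  apply: near0_interval.
  have q_ge : - clock < qmatrix x x.
    rewrite /qmatrix eqxx mulr1 ltrBrDr.
    have := exit_rate_le delta lambda_ge0 x.
    have : 0 <= jump_rate delta lambda x x.
      apply: sumr_ge0 => i _; rewrite addr_ge0 // mulr_ge0 //.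
        exact: up_ge0.
      exact: down_ge0.
    by lra.
  apply: filterS2 (nbhs_right_gt 0) (cvgr_gt _ (@trans_rates x x) _ q_ge) => t /=.
  move=> t0; rewrite eqxx /= => /ltW.
  by rewrite mulrC ler_pdivlMr // mulNr; lra.
rewrite le_eqVlt => /orP[/eqP <-|h0].
  by rewrite trans_start mulr0 subr0.
pose n := Num.trunc (h / e); pose tau := h / n.+1%:R.
have n0 : 0 < n.+1%:R :> R by rewrite ltr0n.
have tau0 : 0 < tau by rewrite divr_gt0.
have tau_e : tau < e.
  rewrite ltr_pdivrMr // mulrC -ltr_pdivrMr //.
  by have := truncn_itv (divr_ge0 (ltW h0) (ltW e0)) => /andP[].
suff H k : 1 - clock * (k%:R * tau) <= trans [set x] (k%:R * tau) x.
  by have := H n.+1; rewrite /tau mulrC (mulrC (n.+1%:R)) mulfVK ?gt_eqF // mulrC.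
elim: k => [|k IH]; first by rewrite mul0r mulr0 subr0 trans_start.
have -> : k.+1%:R * tau = tau + k%:R * tau by rewrite -natr1; ring.
have kt : 0 <= k%:R * tau by rewrite mulr_ge0 // ltW.
have [neg|pos] := leP (1 - clock * (tau + k%:R * tau)) 0.
  by apply: le_trans neg _; exact: trans_ge0.
apply: le_trans (trans_add_ge x (ltW tau0) kt).
have ct : 0 <= clock * tau by rewrite mulr_ge0 // ltW.
have ckt : 0 <= clock * (k%:R * tau) by rewrite mulr_ge0 // ltW.
have tau_e' : 0 < tau < e by rewrite tau0.
have l1 : 0 <= 1 - clock * tau by move: pos; lra.
have l2 : 0 <= 1 - clock * (k%:R * tau) by move: pos; lra.
apply: le_trans (ler_pM l1 l2 (small _ tau_e') IH).
by have := mulr_ge0 ct ckt; lra.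
Qed.

Lemma trans_lipschitz A h t x : 0 <= h -> 0 <= t ->
  `|trans A (t + h) x - trans A t x| <= clock * h.
Proof.
move=> h0 t0; rewrite (addrC t); apply: le_trans (trans_lipschitz_stay A x h0 t0) _.
by have := trans_stay x h0; lra.
Qed.

Definition neighbours x : seq (N.-tuple nat) :=
  undup (x :: [seq incr x i | i <- enum 'I_N] ++ [seq decr x i | i <- enum 'I_N]).

Lemma sum_pick (s : seq (N.-tuple nat)) (f : N.-tuple nat -> R) z :
  uniq s -> z \in s -> \sum_(y <- s) (y == z)%:R * f y = f z.
Proof.
move=> us zs; rewrite (bigD1_seq z) //= eqxx mul1r big1 ?addr0 // => y /negPf ->.
by rewrite mul0r.
Qed.

Lemma sum_qmatrix f x : \sum_(y <- neighbours x) qmatrix x y * f y = gen f x.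
Proof.
have us : uniq (neighbours x) by exact: undup_uniq.
have xs : x \in neighbours x by rewrite mem_undup inE eqxx.
have ins i : incr x i \in neighbours x.
  by rewrite mem_undup inE mem_cat map_f ?orbT // mem_enum.
have des i : decr x i \in neighbours x.
  by rewrite mem_undup inE mem_cat (map_f (decr x)) ?orbT // mem_enum.
rewrite genE -(sum_pick f us xs) mulr_sumr.
under eq_bigr do rewrite mulrBl.
rewrite sumrB; congr (_ - _); last by apply: eq_bigr => y _; rewrite mulrA.
under eq_bigr do rewrite /jump_rate mulr_suml.
rewrite exchange_big /=; apply: eq_bigr => i _.
rewrite -(sum_pick f us (ins i)) -(sum_pick f us (des i)) !mulr_sumr -big_split.
by apply: eq_bigr => y _ /=; rewrite mulrDl !mulrA.
Qed.

Lemma trans_rates_sum s x (e : R) : 0 < e -> \forall h \near 0^'+,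
  \sum_(y <- s) `|trans [set y] h x - (y == x)%:R - h * qmatrix x y| <= e * h.
Proof.
elim: s e => [|z s IH] e e0.
  apply: filterS (nbhs_right_gt 0) => h h0.
  by rewrite big_nil; apply: mulr_ge0; exact: ltW.
have e2 : 0 < e / 2 by rewrite divr_gt0.
have near_z : \forall t \near 0^'+, `|qmatrix x z
    - t^-1 * (trans [set z] t x - (z == x)%:R)| < e / 2.
  exact: cvgr_dist_lt (@trans_rates x z) _ e2.
apply: filterS3 (IH _ e2) (nbhs_right_gt 0) near_z => h hs h0 hz.
rewrite big_cons.
suff : `|trans [set z] h x - (z == x)%:R - h * qmatrix x z| <= e / 2 * h by lra.
have -> : trans [set z] h x - (z == x)%:R - h * qmatrix x z
    = - (h * (qmatrix x z - h^-1 * (trans [set z] h x - (z == x)%:R))).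
  by field; rewrite gt_eqF.
by rewrite normrN normrM gtr0_norm // mulrC ler_wpM2r ?(ltW h0) // ltW.
Qed.

(** The neighbours of [x] receive all the rates out of [x], so that the
    probability of being elsewhere after a time [h] is [o(h)]; by [trans_step],
    the backward equation at [x] then holds with an error that depends neither
    on [A] nor on [t]. *)
Lemma trans_backward x (e : R) : 0 < e -> exists2 h0 : R, 0 < h0 &
  forall h, 0 < h < h0 -> forall A t, 0 <= t ->
    `|trans A (t + h) x - trans A t x - h * gen (trans A t) x| <= e * h.
Proof.
move=> e0; apply: near0_interval.
have e2 : 0 < e / 2 by rewrite divr_gt0.
apply: filterS2 (trans_rates_sum (neighbours x) x e2) (nbhs_right_gt 0).
move=> h; set D := \sum_(y <- _) _ => hD h0 A t t0.
have us : uniq (neighbours x) by exact: undup_uniq.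
have xs : x \in neighbours x by rewrite mem_undup inE eqxx.
rewrite (addrC t); have /andP[] := trans_step A x us (ltW h0) t0.
set r := trans A (h + t) x - _ => r0 r1.
pose q y := trans [set y] h x - (y == x)%:R - h * qmatrix x y.
have qf (f : N.-tuple nat -> R) : \sum_(y <- neighbours x) q y * f y
    = \sum_(y <- neighbours x) trans [set y] h x * f y - f x - h * gen f x.
  rewrite -sum_qmatrix -[in f x](sum_pick f us xs) mulr_sumr -!sumrB.
  by apply: eq_bigr => y _; rewrite /q; ring.
have -> : trans A (h + t) x - trans A t x - h * gen (trans A t) x
    = r + \sum_(y <- neighbours x) q y * trans A t y.
  by rewrite qf /r; ring.
have gen1 : gen (fun=> 1) x = 0.
  by rewrite /gen big1 // => i _; rewrite subrr !mulr0 addr0.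
have rq : r <= - \sum_(y <- neighbours x) q y.
  have := qf (fun=> 1); rewrite gen1 mulr0 subr0.
  under eq_bigr do rewrite mulr1.
  under [in X in _ = X -> _]eq_bigr do rewrite mulr1.
  by move=> ->; rewrite opprB.
have qD : `|\sum_(y <- neighbours x) q y| <= D by exact: ler_norm_sum.
have qtD : `|\sum_(y <- neighbours x) q y * trans A t y| <= D.
  apply: le_trans (ler_norm_sum _ _ _) _; apply: ler_sum => y _.
  rewrite normrM ler_piMr // ger0_norm ?trans_ge0 //; exact: trans_le1.
apply: le_trans (ler_normD _ _) _; rewrite (ger0_norm r0).
have := ler_norm (- \sum_(y <- neighbours x) q y); rewrite normrN.
by move: hD qD qtD rq; lra.
Qed.

(** The constant in the second-order term does not depend on [x], although the
    hypothesis on the rates is not uniform in [x].  An interval of length [h] is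
    cut into [n] equal parts.  On each of them, the error of the backward
    equation is as small as desired if [n] is large, and the effect of
    freezing the generator at time [t] is controlled by the Lipschitz
    bound, in which only the bound on the exit rates appears. *)
Lemma trans_expansion A t h x : 0 <= t -> 0 < h ->
  `|trans A (t + h) x - trans A t x - h * gen (trans A t) x|
    <= 2 * clock ^+ 2 * h ^+ 2.
Proof.
move=> t0 h0; have c0 := clock_gt0 N delta_ge0 lambda_ge0.
apply/ler_addgt0Pr => e e0.
have eh0 : 0 < e / h by rewrite divr_gt0.
have [h1 h1_gt0 loc] := trans_backward x eh0.
pose n := Num.trunc (h / h1); pose tau := h / n.+1%:R.
have n0 : 0 < n.+1%:R :> R by rewrite ltr0n.
have tau0 : 0 < tau by rewrite divr_gt0.
have tau_h1 : 0 < tau < h1.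
  rewrite tau0 ltr_pdivrMr // mulrC -ltr_pdivrMr //.
  by have := truncn_itv (divr_ge0 (ltW h0) (ltW h1_gt0)) => /andP[].
have ntau : n.+1%:R * tau = h by rewrite /tau mulrC mulfVK // gt_eqF.
pose K := e / h + 2 * clock ^+ 2 * h.
suff H k : (k <= n.+1)%N -> `|trans A (t + k%:R * tau) x - trans A t x
    - k%:R * tau * gen (trans A t) x| <= k%:R * tau * K.
  have := H _ (leqnn _); rewrite ntau /K => /le_trans; apply.
  rewrite le_eqVlt; apply/orP; left; apply/eqP.
  by field; rewrite gt_eqF.
elim: k => [|k IH] kn.
  by rewrite !mul0r addr0 !subrr normr0.
have kt : 0 <= k%:R * tau by rewrite mulr_ge0 // ltW.
have kth : k%:R * tau <= h.
  by rewrite -ntau ler_wpM2r ?(ltW tau0) // ler_nat ltnW.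
pose u := trans A (t + k%:R * tau).
have e1 : `|trans A (t + k%:R * tau + tau) x - u x - tau * gen u x| <= e / h * tau.
  by apply: loc => //; rewrite addr_ge0.
have e2 : `|gen u x - gen (trans A t) x| <= 2 * clock ^+ 2 * h.
  have -> : gen u x - gen (trans A t) x = gen (fun y => - 1 * trans A t y + u y) x.
    by rewrite gen_linear mulN1r addrC.
  have -> : 2 * clock ^+ 2 * h = 2 * clock * (clock * h) by ring.
  apply: gen_norm => // y; rewrite mulN1r addrC.
  apply: le_trans (trans_lipschitz A y kt t0) _.
  by rewrite ler_wpM2l // ltW.
have -> : trans A (t + k.+1%:R * tau) x - trans A t x
      - k.+1%:R * tau * gen (trans A t) x
    = (trans A (t + k%:R * tau + tau) x - u x - tau * gen u x)
      + tau * (gen u x - gen (trans A t) x)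
      + (u x - trans A t x - k%:R * tau * gen (trans A t) x).
  by rewrite -natr1 mulrDl mul1r addrA; ring.
have -> : k.+1%:R * tau * K = e / h * tau + tau * (2 * clock ^+ 2 * h)
    + k%:R * tau * K by rewrite /K -natr1; ring.
apply: le_trans (ler_normD _ _) _; apply: lerD; last exact/IH/ltnW.
apply: le_trans (ler_normD _ _) _; apply: lerD => //.
by rewrite normrM gtr0_norm // ler_wpM2l // ltW.
Qed.

Lemma trans_euler A :
  euler_consistent (jump_chain delta lambda) clock (2 * clock ^+ 2) (trans A).
Proof.
move=> t h x t0 h0 _.
have -> : lazy (clock * h) (jump_chain delta lambda) (trans A t) x
    = trans A t x + h * gen (trans A t) x.
  rewrite /lazy /jump_chain.
  have := clock_gt0 N delta_ge0 lambda_ge0; move: (clock) => c c0.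
  by field; rewrite gt_eqF.
by rewrite opprD addrA; exact: trans_expansion.
Qed.

End Process.

(** * Uniform limits of probability measures *)

Section UniformLimit.
Context {R : realType} {d : measure_display} {T : measurableType d}.
Implicit Types (A B : set T) (F : nat -> set T).

Lemma finite_additivity (m : set T -> R) F n :
    m set0 = 0 ->
    (forall A B, measurable A -> measurable B -> A `&` B = set0 ->
      m (A `|` B) = m A + m B) ->
    (forall i, measurable (F i)) -> trivIset setT F ->
  m (\bigcup_(i < n) F i) = \sum_(i < n) m (F i).
Proof.
move=> m0 mU mF tF; elim: n => [|n IH].
  by rewrite bigcup_mkord !big_ord0.
rewrite bigcup_mkord !big_ord_recr -bigcup_mkord /= mU ?IH //.
  exact: bigcup_measurable.
apply/seteqP; split=> // w [[i /= ilt Fi] Fn].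
by move: ilt; rewrite (tF i n I I (ex_intro _ w (conj Fi Fn))) ltnn.
Qed.

Variables (mu : nat -> probability T R) (eps : nat -> R) (l : set T -> R).
Hypothesis eps_small : forall e, 0 < e -> exists n, eps n < e.
Hypothesis l_ge0 : forall A, 0 <= l A.
Hypothesis l_limit : forall A, measurable A ->
  forall n, `|fine (mu n A) - l A| <= eps n.

Let eps_zero (a c : R) : 0 < c -> (forall n, `|a| <= c * eps n) -> a = 0.
Proof.
move=> c0 h; apply/eqP; rewrite -normr_eq0 eq_le normr_ge0 andbT.
apply/ler_addgt0Pr => e e0; rewrite add0r.
have [n hn] := eps_small (divr_gt0 e0 c0).
apply: le_trans (h n) _.
by move: hn; rewrite ltr_pdivlMr // mulrC => /ltW.
Qed.

Let l0 : l set0 = 0.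
Proof.
apply: (@eps_zero _ 1) => // n; rewrite mul1r.
by have := l_limit measurable0 n; rewrite measure0 sub0r normrN.
Qed.

Let lT : l setT = 1.
Proof.
apply/eqP; rewrite -subr_eq0; apply/eqP; apply: (@eps_zero _ 1) => // n.
by rewrite mul1r; have := l_limit measurableT n; rewrite probability_setT distrC.
Qed.

Let lU A B : measurable A -> measurable B -> A `&` B = set0 ->
  l (A `|` B) = l A + l B.
Proof.
move=> mA mB AB; apply/eqP; rewrite -subr_eq0; apply/eqP.
apply: (@eps_zero _ 3) => // n.
have := l_limit mA n; have := l_limit mB n; have := l_limit (measurableU _ _ mA mB) n.
rewrite finePU //; set a := fine _; set b := fine _ => h1 h2 h3.
have -> : l (A `|` B) - (l A + l B)
    = (a - l A) + (b - l B) - (a + b - l (A `|` B)) by ring.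
apply: le_trans (ler_normB _ _) _.
by have := ler_normD (a - l A) (b - l B); lra.
Qed.

Definition limit_law A : \bar R := (l A)%:E.

Let limit_law0 : limit_law set0 = 0%E.
Proof. by rewrite /limit_law l0. Qed.

Let limit_law_ge0 A : (0 <= limit_law A)%E.
Proof. by rewrite lee_fin. Qed.

Let limit_law_sigma_additive : semi_sigma_additive limit_law.
Proof.
move=> F mF tF mUF.
have mn n : measurable (\bigcup_(i < n) F i) by exact: bigcup_measurable.
have -> : (fun n => \sum_(0 <= i < n) limit_law (F i))%E
    = EFin \o (fun n => l (\bigcup_(i < n) F i)).
  apply: funext => n /=.
  by rewrite (finite_additivity n l0 lU mF tF) big_mkord sumEFin.
apply: cvg_EFin; first by near=> n.
rewrite -[_ \o _]/(fun n => l (\bigcup_(i < n) F i)).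
apply/cvgrPdist_lt => e e0.
have e3 : 0 < e / 3 by rewrite divr_gt0.
have [k hk] := eps_small e3.
have muU : fine (mu k (\bigcup_(i < n) F i)) @[n --> \oo]
    --> fine (mu k (\bigcup_i F i)).
  apply: fine_cvg; rewrite fineP_EFin //.
  have := @measure_semi_sigma_additive _ _ _ (mu k) F mF tF mUF.
  suff -> : (fun n => mu k (\bigcup_(i < n) F i))
    = (fun n => \sum_(0 <= i < n) mu k (F i))%E by [].
  apply: funext => n; rewrite -[LHS]fineP_EFin //.
  rewrite (finite_additivity (m := fun A => fine (mu k A))) //.
  - rewrite big_mkord -sumEFin; apply: eq_bigr => i _.
    by rewrite fineP_EFin.
  - by rewrite measure0.
  - by move=> A B mA mB AB; rewrite finePU.
near=> n.
have h1 : `|fine (mu k (\bigcup_i F i)) - fine (mu k (\bigcup_(i < n) F i))| < e / 3.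
  by near: n; exact: cvgr_dist_lt muU _ e3.
have h2 := l_limit mUF k; have h3 := l_limit (mn n) k.
move: h1 h2 h3; set a := fine _; set b := fine _ => h1 h2 h3.
have -> : l (\bigcup_i F i) - l (\bigcup_(i < n) F i)
  = (b - l (\bigcup_(i < n) F i)) + (a - b) - (a - l (\bigcup_i F i)) by ring.
apply: le_lt_trans (ler_normB _ _) _.
have := ler_normD (b - l (\bigcup_(i < n) F i)) (a - b).
by lra.
Unshelve. all: by end_near. Qed.

HB.instance Definition _ := isMeasure.Build _ _ _ limit_law
  limit_law0 limit_law_ge0 limit_law_sigma_additive.

Let limit_law_setT : limit_law setT = 1%E.
Proof. by rewrite /limit_law lT. Qed.

HB.instance Definition _ :=
  Measure_isProbability.Build _ _ _ limit_law limit_law_setT.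

Lemma limit_law_probability : exists pi : probability T R,
  forall A, fine (pi A) = l A.
Proof. by exists limit_law. Qed.

End UniformLimit.

(** Countable additivity is preserved because the convergence is uniform in the
    event.  No limit has to be taken to define the value of the limit measure:
    the intervals of radius [eps n] around the values at time [n] have a point
    in common. *)
Lemma uniform_limit_probability (R : realType) (d : measure_display)
    (T : measurableType d) (mu : nat -> probability T R) (eps : nat -> R) :
    (forall e, 0 < e -> exists n, eps n < e) ->
    (forall A, measurable A -> forall n m, (n <= m)%N ->
      `|fine (mu n A) - fine (mu m A)| <= eps n) ->
  exists pi : probability T R, forall A, measurable A ->
    forall n, `|fine (mu n A) - fine (pi A)| <= eps n.
Proof.
move=> eps_small cauchy.
have eps_ge0 n : 0 <= eps n.
  by have := cauchy _ measurable0 n n (leqnn n); rewrite subrr normr0.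
have /choice[l hl] : forall A : set T, exists c, measurable A ->
    forall n, `|fine (mu n A) - c| <= eps n.
  move=> A.
  have [mA|nA] := pselect (measurable A); last by exists 0.
  have [c hc] : exists c, forall n, `|fine (mu n A) - c| <= 1 * eps n.
    apply: (lipschitz_recentre 0%N) => n m; rewrite mul1r.
    have [nm|/ltnW mn] := leqP n m.
      by apply: le_trans (cauchy A mA n m nm) _; rewrite lerDl.
    by rewrite distrC; apply: le_trans (cauchy A mA m n mn) _; rewrite lerDr.
  by exists c => _ n; have := hc n; rewrite mul1r.
(* The value of [l] outside of the measurable sets is arbitrary, and could be
   negative. *)
have hl' A : measurable A -> forall n, `|fine (mu n A) - `|l A| | <= eps n.
  move=> mA n; apply: le_trans (hl A mA n).
  by rewrite -[X in `|X - _|]ger0_norm ?fineP_ge0 //; exact: ler_dist_dist.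
have [pi hpi] := limit_law_probability eps_small (fun A => normr_ge0 (l A)) hl'.
by exists pi => A mA n; rewrite hpi; exact: hl'.
Qed.

(** * Exponential ergodicity *)

Lemma expR_decay (R : realType) (kappa : R) n : 0 < kappa ->
  expR (- (kappa * n.+1%:R)) <= kappa^-1 / n.+1%:R.
Proof.
move=> k0; have y0 : 0 < kappa * n.+1%:R by rewrite mulr_gt0 // ltr0n.
rewrite expRN -invfM lef_pV2 ?posrE ?expR_gt0 //.
by apply: le_trans (expR_ge1Dx _); rewrite lerDr.
Qed.

Lemma tv_dist_le (R : realType) (d : measure_display) (T : measurableType d)
    (mu nu : probability T R) (b : R) :
  (tv_dist mu nu <= b%:E)%E <->
  forall A, measurable A -> `|fine (mu A) - fine (nu A)| <= b.
Proof.
have e A : measurable A ->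
    `|mu A - nu A|%E = (`|fine (mu A) - fine (nu A)|)%:E.
  by move=> mA; rewrite -{1}(fineP_EFin mu mA) -{1}(fineP_EFin nu mA) -EFinB.
split=> [h A mA|h].
  rewrite -lee_fin -e //; apply: le_trans h.
  by apply: ereal_sup_ubound; exists A.
by apply: ge_ereal_sup => _ [A mA <-]; rewrite e // lee_fin; exact: h.
Qed.

Section Ergodicity.
Variables (R : realType) (N : nat).
Variables (d : measure_display) (Omega : measurableType d).
Variables (P : N.-tuple nat -> probability Omega R).
Variables (X : R -> {mfun Omega >-> N.-tuple nat}).

Lemma converges_exponentially_integer_times (pi : probability (N.-tuple nat) R) x :
    converges_exponentially P X pi ->
  exists c, forall A, measurable A -> forall n,
    `|trans P X A n.+1%:R x - fine (pi A)| <= c / n.+1%:R.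
Proof.
move=> [rho [/andP[r0 r1] [C hC]]].
have k0 : 0 < - ln rho by rewrite oppr_gt0 ln_lt0 // r0.
exists (`|C x| * (- ln rho)^-1) => A mA n.
have n0 : 0 < n.+1%:R :> R by rewrite ltr0n.
have /tv_dist_le/(_ A mA)/le_trans := hC x _ n0; apply.
rewrite -mulrA; apply: (@le_trans _ _ (`|C x| * rho `^ n.+1%:R)).
  by rewrite ler_wpM2r ?powR_ge0 ?ler_norm.
rewrite ler_wpM2l //; apply: le_trans (expR_decay n k0).
by rewrite /powR gt_eqF // mulNr opprK mulrC.
Qed.

(** Convergence of the laws from one starting point determines the limit. *)
Lemma converges_exponentially_unique (pi pi' : probability (N.-tuple nat) R) :
    converges_exponentially P X pi -> converges_exponentially P X pi' ->
  forall A, measurable A -> pi' A = pi A.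
Proof.
move=> /(@converges_exponentially_integer_times _ (origin N)) [c hc].
move=> /(@converges_exponentially_integer_times _ (origin N)) [c' hc'] A mA.
rewrite -(fineP_EFin pi mA) -(fineP_EFin pi' mA); congr (_%:E).
apply/eqP; rewrite -subr_eq0 -normr_eq0 eq_le normr_ge0 andbT.
apply: (@le_of_le_add_div _ _ _ (c + c') 0) => n _; rewrite add0r mulrDl.
have := hc A mA n; have := hc' A mA n; set a := trans _ _ _ _ _ => h1 h2.
have -> : fine (pi' A) - fine (pi A) = (a - fine (pi A)) - (a - fine (pi' A)).
  by ring.
by apply: le_trans (ler_normB _ _) _; rewrite lerD.
Qed.

(** The law from [origin] at integer times is a Cauchy sequence, uniformly in
    the event; its limit also attracts the laws from the other states, as the
    influence of the starting point vanishes. *)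
Lemma converges_exponentially_exists (V : N.-tuple nat -> R) (C b kappa : R) :
    (forall x, 0 <= V x) -> 0 <= b -> 0 <= C -> 0 < kappa ->
    (forall A t, 0 < t ->
      (forall x y, `|trans P X A t x - trans P X A t y|
        <= C * expR (- (kappa * t)) * (1 + V x + V y)) /\
      (forall s x, 0 < s -> `|trans P X A (t + s) x - trans P X A t x|
        <= C * expR (- (kappa * t)) * (1 + 2 * V x + b))) ->
  exists pi : probability (N.-tuple nat) R, converges_exponentially P X pi.
Proof.
move=> V0 b0 C0 k0 decay.
pose z := origin N.
pose D x := C * (1 + 2 * V x + b).
have D0 x : 0 <= D x by rewrite mulr_ge0 // addr_ge0 // addr_ge0 // mulr_ge0.
pose mu n : probability (N.-tuple nat) R := distribution (P z) (X n.+1%:R).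
pose eps n := D z * expR (- (kappa * n.+1%:R)).
have eps_le n : eps n <= D z / kappa / n.+1%:R.
  by rewrite /eps -mulrA ler_wpM2l // expR_decay.
have eps_small e : 0 < e -> exists n, eps n < e.
  move=> e0; pose w := D z / kappa / e.
  have w0 : 0 <= w by apply: divr_ge0; [apply: divr_ge0 => //|]; exact: ltW.
  exists (Num.trunc w); apply: le_lt_trans (eps_le _) _.
  rewrite ltr_pdivrMr ?ltr0n // (mulrC e) -ltr_pdivrMr //.
  by have := truncn_itv w0 => /andP[].
have cauchy A : measurable A -> forall n m, (n <= m)%N ->
    `|fine (mu n A) - fine (mu m A)| <= eps n.
  move=> _ n m; rewrite leq_eqVlt => /orP[/eqP ->|nm].
    by rewrite subrr normr0 mulr_ge0 // expR_ge0.
  have n0 : 0 < n.+1%:R :> R by rewrite ltr0n.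
  have s0 : 0 < m.+1%:R - n.+1%:R :> R by rewrite subr_gt0 ltr_nat.
  have := (decay A _ n0).2 _ z s0.
  by rewrite subrKC distrC mulrAC.
have [pi hpi] := uniform_limit_probability eps_small cauchy.
exists pi, (expR (- kappa)); split.
  by rewrite expR_gt0 expR_lt1 oppr_lt0.
exists D => x t t0; apply/tv_dist_le => A mA.
have -> : D x * expR (- kappa) `^ t = D x * expR (- (kappa * t)).
  by rewrite /powR gt_eqF ?expR_gt0 // expRK mulrN (mulrC t).
rewrite -[fine (distribution _ _ _)]/(trans P X A t x).
pose c := C * (1 + V x + V z) / kappa + D z / kappa.
apply: (@le_of_le_add_div _ _ _ c (Num.trunc t)) => n hn.
have n0 : 0 < n.+1%:R :> R by rewrite ltr0n.
have s0 : 0 < n.+1%:R - t.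
  rewrite subr_gt0; have := truncn_itv (ltW t0) => /andP[_ /lt_le_trans]; apply.
  by rewrite ler_nat ltnS.
have h1 := (decay A t t0).2 _ x s0.
have h2 := (decay A _ n0).1 x z.
have h3 := hpi A mA n; rewrite -[fine (mu n A)]/(trans P X A n.+1%:R z) in h3.
have h2' : `|trans P X A n.+1%:R x - trans P X A n.+1%:R z|
    <= C * (1 + V x + V z) / kappa / n.+1%:R.
  apply: le_trans h2 _; rewrite [leLHS]mulrAC -[leRHS]mulrA ler_wpM2l ?expR_decay //.
  by rewrite mulr_ge0 // !addr_ge0.
have h3' := le_trans h3 (eps_le n).
move: h1; rewrite subrKC mulrAC -/(D x) distrC => h1.
set u := trans P X A t x in h1 *; set v := trans P X A n.+1%:R x in h1 h2' *.
set w := trans P X A n.+1%:R z in h2' h3'.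
have -> : u - fine (pi A) = (u - v) + ((v - w) + (w - fine (pi A))) by ring.
apply: le_trans (ler_normD _ _) _; apply: lerD => //.
by apply: le_trans (ler_normD _ _) _; rewrite /c [leRHS]mulrDl lerD.
Qed.

End Ergodicity.

Theorem theorem1 (R : realType) (N : nat) (delta lambda : R)
    (d : measure_display) (Omega : measurableType d)
    (P : N.-tuple nat -> probability Omega R)
    (X : R -> {mfun Omega >-> N.-tuple nat})
    (hN : (2 <= N)%N) (hdelta : 0 <= delta)
    (hlambda : 12 * delta + 8 * delta ^+ 2 < lambda)
    (hX : small_jump_model delta lambda P X) :
  exists pi : probability (N.-tuple nat) R,
    converges_exponentially P X pi /\
    forall pi' : probability (N.-tuple nat) R,
      converges_exponentially P X pi' ->
      forall A : set (N.-tuple nat), measurable A -> pi' A = pi A.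
Proof.
have d2 : 0 <= delta ^+ 2 by rewrite exprn_ge0.
have lambda_ge0 : 0 <= lambda by lra.
have hl : 6 * delta + 3 * delta ^+ 2 < lambda by lra.
have [V [s [theta [b [s0 /andP[theta0 theta1] b0 V_ge genV]]]]] :=
  lyapunov_function hdelta lambda_ge0 hN hl.
have V0 x : 0 <= V x by apply: le_trans (V_ge x); rewrite mulr_ge0 // ltW.
have c1 := clock_ge1 N hdelta lambda_ge0.
have c0 := clock_gt0 N hdelta lambda_ge0.
pose g := 1 - theta / clock N delta lambda.
have g01 : 0 <= g < 1.
  rewrite subr_ge0 ler_pdivrMr // mul1r (le_trans theta1 c1) /=.
  by rewrite ltrBlDr ltrDl divr_gt0.
have dr : drift (jump_chain delta lambda) V g b.
  move=> x; rewrite /jump_chain /g.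
  have ci : 0 <= (clock N delta lambda)^-1 by rewrite invr_ge0 ltW.
  by have := ler_wpM2l ci (genV x); lra.
have hirr L : exists m (alpha : R), [/\ (0 < m)%N, 0 < alpha <= 1 &
    forall f, (forall y, 0 <= f y) -> forall x, V x <= L ->
      alpha * f (origin N) <= iter m (jump_chain delta lambda) f x].
  pose m := (Num.trunc (`|L| / s)).+1.
  exists m, ((clock N delta lambda)^-1 ^+ m); split=> //.
    by rewrite exprn_gt0 ?invr_gt0 //= exprn_ile1 ?invr_ge0 ?invf_le1 // ltW.
  move=> f f0 x hx; apply: jump_chain_origin => //.
  have w0 : 0 <= `|L| / s by rewrite divr_ge0 // ltW.
  rewrite ltnW // -(ltr_nat R); have := truncn_itv w0 => /andP[_].
  apply: le_lt_trans; rewrite ler_pdivlMr // mulrC.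
  by apply: le_trans (V_ge x) _; apply: le_trans hx _; exact: ler_norm.
have [C [kappa [C0 kappa0 decay]]] :=
  harris_continuous_time (markov_jump_chain N hdelta lambda_ge0) V0 g01 b0 dr c0 hirr.
have [pi hpi] : exists pi : probability (N.-tuple nat) R,
    converges_exponentially P X pi.
  apply: (converges_exponentially_exists V0 b0 C0 kappa0) => A t t0.
  apply: decay t0; first exact: trans_euler.
  move=> x y; rewrite ler_norml.
  have := trans_ge0 P X A 0 x; have := trans_le1 P X A 0 x.
  have := trans_ge0 P X A 0 y; have := trans_le1 P X A 0 y.
  by lra.
by exists pi; split=> // pi'; exact: converges_exponentially_unique.
Qed.
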